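(* For every $n\ge 1$, $\pi_n(K(S^1))$ is isomorphic to $Lie(n)$.
   Context: Commutator: $[a,b]=a^{-1}b^{-1}ab$. $S^1$ is the simplicial circle $\Delta[1]/\partial\Delta[1]$. For a pointed simplicial set $S$, Milnor's construction $F(S)$ is the simplicial group with $F(S)_n$ the free group on $S_n$ modulo the relation $*=1$, with faces and degeneracies induced from $S$. Cohen's construction $K(S)$ is the quotient simplicial group of $F(S)$ modulo the normal simplicial subgroup generated by all iterated commutators $[[\cdots[x_1,x_2],\cdots],x_t]$ with $x_1,\dots,x_t$ simplices of $S$ (of the same dimension) and $x_i=x_j$ for some $1\le i<j\le t$. $Lie(n)$ is the abelian group of elements of weight $n$ in the Lie algebra $Lie(x_1,\dots,x_n)$, the quotient of the free Lie algebra $L(x_1,\dots,x_n)$ over $\mathbf{Z}$ by the two-sided Lie ideal generated by the Lie elements $[[\cdots[x_{i_1},x_{i_2}],\cdots],x_{i_t}]$ with $i_l=i_k$ for some $1\le l<k\le t$. *)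

(* Defs.v *)
From HB Require Import structures.
From mathcomp Require Import all_boot ssralg.
From mathcomp Require Import boolp zify.

Set Implicit Arguments.
Unset Strict Implicit.
Unset Printing Implicit Defensive.

Import GRing.Theory.

Local Open Scope quotient_scope.
Local Open Scope group_scope.

Record gcongr (G : groupType) := GCongr {
  gcong :> G -> G -> Prop;
  gcong_refl : forall x, gcong x x;
  gcong_sym : forall x y, gcong x y -> gcong y x;
  gcong_trans : forall x y z, gcong x y -> gcong y z -> gcong x z;
  gcongM : forall x x' y y', gcong x x' -> gcong y y' -> gcong (x * y) (x' * y')
}.

Section QuotientGroup.
Variables (G : groupType) (E : gcongr G).

Definition gcongb : rel G := fun x y => `[< E x y >].

Lemma gcongb_refl : reflexive gcongb.
Proof. by move=> x; apply/asboolP; apply: gcong_refl. Qed.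

Lemma gcongb_sym : symmetric gcongb.
Proof. by move=> x y; apply/asboolP/asboolP; apply: gcong_sym. Qed.

Lemma gcongb_trans : transitive gcongb.
Proof.
by move=> y x z /asboolP xy /asboolP yz; apply/asboolP; apply: gcong_trans xy yz.
Qed.

Canonical gcong_equiv := EquivRel gcongb gcongb_refl gcongb_sym gcongb_trans.

Definition gquot := {eq_quot gcong_equiv}.

HB.instance Definition _ := Choice.on gquot.
HB.instance Definition _ := EqQuotient.on gquot.

Definition gclass (x : G) : gquot := \pi_gquot x.

Lemma gclass_eq x y : gclass x = gclass y <-> E x y.
Proof.
split=> [/eqP|xy]; first by rewrite /gclass eqmodE => /asboolP.
by apply/eqP; rewrite /gclass eqmodE; apply/asboolP.
Qed.

Lemma gclass_repr (u : gquot) : gclass (repr u) = u.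
Proof. exact: reprK. Qed.

Lemma gclassP (u : gquot) : exists x, u = gclass x.
Proof. by exists (repr u); rewrite gclass_repr. Qed.

Lemma repr_gclass x : E (repr (gclass x)) x.
Proof. by apply/gclass_eq; rewrite gclass_repr. Qed.

Definition gquot_one : gquot := gclass 1.
Definition gquot_mul (u v : gquot) : gquot := gclass (repr u * repr v).
Definition gquot_inv (u : gquot) : gquot := gclass (repr u)^-1.

Lemma gclass_mul x y : gquot_mul (gclass x) (gclass y) = gclass (x * y).
Proof. by apply/gclass_eq/gcongM; apply: repr_gclass. Qed.

Lemma gcongV x y : E x y -> E x^-1 y^-1.
Proof.
move=> /gcong_sym xy.
have := gcongM (gcong_refl E x^-1) (gcongM xy (gcong_refl E y^-1)).
by rewrite mulgV mulg1 mulgA mulVg mul1g.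
Qed.

Lemma gclass_inv x : gquot_inv (gclass x) = gclass x^-1.
Proof. by apply/gclass_eq/gcongV/repr_gclass. Qed.

Lemma gquot_mulA : associative gquot_mul.
Proof.
move=> u v w; have [x ->] := gclassP u; have [y ->] := gclassP v.
by have [z ->] := gclassP w; rewrite !gclass_mul mulgA.
Qed.

Lemma gquot_mul1 : left_id gquot_one gquot_mul.
Proof. by move=> u; have [x ->] := gclassP u; rewrite gclass_mul mul1g. Qed.

Lemma gquot_mulr1 : right_id gquot_one gquot_mul.
Proof. by move=> u; have [x ->] := gclassP u; rewrite gclass_mul mulg1. Qed.

Lemma gquot_mulV : left_inverse gquot_one gquot_inv gquot_mul.
Proof.
by move=> u; have [x ->] := gclassP u; rewrite gclass_inv gclass_mul mulVg.
Qed.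

Lemma gquot_mulrV : right_inverse gquot_one gquot_inv gquot_mul.
Proof.
by move=> u; have [x ->] := gclassP u; rewrite gclass_inv gclass_mul mulgV.
Qed.

HB.instance Definition _ := isGroup.Build gquot
  gquot_mulA gquot_mul1 gquot_mulr1 gquot_mulV gquot_mulrV.

Lemma gclassM : {morph gclass : x y / x * y}.
Proof. by move=> x y; rewrite -[LHS]gclass_mul. Qed.

Lemma gclass1 : gclass 1 = 1.
Proof. by []. Qed.

Lemma gclassV : {morph gclass : x / x^-1}.
Proof. by move=> x; rewrite -[LHS]gclass_inv. Qed.

End QuotientGroup.

Record normal_subgroup (G : groupType) := NormalSubgroup {
  in_nsub :> G -> Prop;
  nsub1 : in_nsub 1;
  nsubM : forall x y, in_nsub x -> in_nsub y -> in_nsub (x * y);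
  nsubV : forall x, in_nsub x -> in_nsub x^-1;
  nsubJ : forall x y, in_nsub x -> in_nsub (x ^ y)
}.

Section CosetCongruence.
Variables (G : groupType) (N : normal_subgroup G).

Definition coset_rel (x y : G) : Prop := N (x^-1 * y).

Lemma coset_rel_refl x : coset_rel x x.
Proof. by rewrite /coset_rel mulVg; apply: nsub1. Qed.

Lemma coset_rel_sym x y : coset_rel x y -> coset_rel y x.
Proof. by rewrite /coset_rel => /nsubV; rewrite invgM invgK. Qed.

Lemma coset_rel_trans x y z : coset_rel x y -> coset_rel y z -> coset_rel x z.
Proof.
by rewrite /coset_rel => xy yz; have := nsubM xy yz; rewrite mulgA mulgK.
Qed.

Lemma coset_relM x x' y y' :
  coset_rel x x' -> coset_rel y y' -> coset_rel (x * y) (x' * y').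
Proof.
rewrite /coset_rel => xx' yy'; have := nsubM (nsubJ y xx') yy'.
by rewrite /conjg invgM !mulgA mulgK.
Qed.

Definition coset_congr : gcongr G :=
  GCongr coset_rel_refl coset_rel_sym coset_rel_trans coset_relM.

End CosetCongruence.

Inductive normal_closure (G : groupType) (R : G -> Prop) : G -> Prop :=
| NClosureGen x of R x : normal_closure R x
| NClosure1 : normal_closure R 1
| NClosureM x y of normal_closure R x & normal_closure R y :
    normal_closure R (x * y)
| NClosureV x of normal_closure R x : normal_closure R x^-1
| NClosureJ x y of normal_closure R x : normal_closure R (x ^ y).

Definition normal_closure_subgroup (G : groupType) (R : G -> Prop) :=
  NormalSubgroup (NClosure1 R) (@NClosureM G R) (@NClosureV G R)
    (@NClosureJ G R).

Section FreeGroup.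
Variable X : choiceType.

(* [(x, false)] stands for the letter x and [(x, true)] for its inverse. *)
Definition word := seq (X * bool).

Inductive word_eq : word -> word -> Prop :=
| WordRefl u : word_eq u u
| WordSym u v of word_eq u v : word_eq v u
| WordTrans u v w of word_eq u v & word_eq v w : word_eq u w
| WordCat u u' v v' of word_eq u u' & word_eq v v' :
    word_eq (u ++ v) (u' ++ v')
| WordCancel x b : word_eq [:: (x, b); (x, ~~ b)] [::].

Definition word_eqb : rel word := fun u v => `[< word_eq u v >].

Lemma word_eqb_refl : reflexive word_eqb.
Proof. by move=> u; apply/asboolP; apply: WordRefl. Qed.

Lemma word_eqb_sym : symmetric word_eqb.
Proof. by move=> u v; apply/asboolP/asboolP; apply: WordSym. Qed.

Lemma word_eqb_trans : transitive word_eqb.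
Proof.
by move=> v u w /asboolP uv /asboolP vw; apply/asboolP; apply: WordTrans uv vw.
Qed.

Canonical word_equiv := EquivRel word_eqb word_eqb_refl word_eqb_sym word_eqb_trans.

Definition free_group := {eq_quot word_equiv}.

HB.instance Definition _ := Choice.on free_group.
HB.instance Definition _ := EqQuotient.on free_group.

Definition wclass (u : word) : free_group := \pi_free_group u.

Lemma wclass_eq u v : wclass u = wclass v <-> word_eq u v.
Proof.
split=> [/eqP|uv]; first by rewrite /wclass eqmodE => /asboolP.
by apply/eqP; rewrite /wclass eqmodE; apply/asboolP.
Qed.

Lemma wclass_repr (a : free_group) : wclass (repr a) = a.
Proof. exact: reprK. Qed.

Lemma wclassP (a : free_group) : exists u, a = wclass u.
Proof. by exists (repr a); rewrite wclass_repr. Qed.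

Lemma repr_wclass u : word_eq (repr (wclass u)) u.
Proof. by apply/wclass_eq; rewrite wclass_repr. Qed.

Definition word_inv (u : word) : word := rev [seq (p.1, ~~ p.2) | p <- u].

Lemma word_invK : involutive word_inv.
Proof.
move=> u; rewrite /word_inv map_rev revK -map_comp -[RHS]map_id.
by apply: eq_map => -[x b] /=; rewrite negbK.
Qed.

Lemma word_inv_cat u v : word_inv (u ++ v) = word_inv v ++ word_inv u.
Proof. by rewrite /word_inv map_cat rev_cat. Qed.

Lemma word_eq_inv u v : word_eq u v -> word_eq (word_inv u) (word_inv v).
Proof.
elim=> [w|w w' _|w w' w'' _ h _|w w' t t' _ h _ h'|x b].
- exact: WordRefl.
- exact: WordSym.
- exact: WordTrans h.
- by rewrite !word_inv_cat; apply: WordCat.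
- by rewrite /word_inv /= /rev /= negbK; apply: WordCancel.
Qed.

Lemma word_mulV u : word_eq (u ++ word_inv u) [::].
Proof.
elim: u => [|[x b] u IHu]; first exact: WordRefl.
rewrite -cat1s word_inv_cat catA -(catA [:: _]).
apply: WordTrans (WordCancel x b).
apply: (@WordCat _ [:: (x, b)] _ [:: (x, ~~ b)]); last exact: WordRefl.
rewrite -[X in word_eq _ X]cats0.
by apply: WordCat => //; apply: WordRefl.
Qed.

Definition fg_one : free_group := wclass [::].
Definition fg_mul (a b : free_group) : free_group := wclass (repr a ++ repr b).
Definition fg_inv (a : free_group) : free_group := wclass (word_inv (repr a)).

Lemma wclass_mul u v : fg_mul (wclass u) (wclass v) = wclass (u ++ v).
Proof. by apply/wclass_eq; apply: WordCat; apply: repr_wclass. Qed.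

Lemma wclass_inv u : fg_inv (wclass u) = wclass (word_inv u).
Proof. exact/wclass_eq/word_eq_inv/repr_wclass. Qed.

Lemma fg_mulA : associative fg_mul.
Proof.
move=> a b c; have [u ->] := wclassP a; have [v ->] := wclassP b.
by have [w ->] := wclassP c; rewrite !wclass_mul catA.
Qed.

Lemma fg_mul1 : left_id fg_one fg_mul.
Proof. by move=> a; have [u ->] := wclassP a; rewrite wclass_mul. Qed.

Lemma fg_mulr1 : right_id fg_one fg_mul.
Proof. by move=> a; have [u ->] := wclassP a; rewrite wclass_mul cats0. Qed.

Lemma fg_mulrV : right_inverse fg_one fg_inv fg_mul.
Proof.
move=> a; have [u ->] := wclassP a; rewrite wclass_inv wclass_mul.
exact/wclass_eq/word_mulV.
Qed.

Lemma fg_mulV : left_inverse fg_one fg_inv fg_mul.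
Proof.
move=> a; have [u ->] := wclassP a; rewrite wclass_inv wclass_mul.
apply/wclass_eq; rewrite -{2}(word_invK u); exact: word_mulV.
Qed.

HB.instance Definition _ := isGroup.Build free_group
  fg_mulA fg_mul1 fg_mulr1 fg_mulV fg_mulrV.

Definition fg_gen (x : X) : free_group := wclass [:: (x, false)].

Lemma wclassM u v : wclass (u ++ v) = wclass u * wclass v.
Proof. by rewrite -[LHS]wclass_mul. Qed.

End FreeGroup.

Section FreeGroupMap.
Variables (X Y : choiceType) (h : X -> Y).

Definition word_map (u : word X) : word Y := [seq (h p.1, p.2) | p <- u].

Lemma word_eq_map u v : word_eq u v -> word_eq (word_map u) (word_map v).
Proof.
elim=> [w|w w' _|w w' w'' _ k _|w w' t t' _ k _ k'|x b].
- exact: WordRefl.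
- exact: WordSym.
- exact: WordTrans k.
- by rewrite /word_map !map_cat; apply: WordCat.
- exact: WordCancel.
Qed.

Definition fg_map (a : free_group X) : free_group Y := wclass (word_map (repr a)).

Lemma fg_map_wclass u : fg_map (wclass u) = wclass (word_map u).
Proof. by apply/wclass_eq/word_eq_map/repr_wclass. Qed.

Lemma fg_map_gen x : fg_map (fg_gen x) = fg_gen (h x).
Proof. exact: fg_map_wclass. Qed.

Lemma fg_mapM : {morph fg_map : a b / a * b}.
Proof.
move=> a b; have [u ->] := wclassP a; have [v ->] := wclassP b.
by rewrite -wclassM !fg_map_wclass /word_map map_cat wclassM.
Qed.

End FreeGroupMap.

Lemma fg_map_id (X : choiceType) (h : X -> X) :
  h =1 id -> fg_map h =1 id.
Proof.
move=> hid a; have [u ->] := wclassP a; rewrite fg_map_wclass; congr wclass.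
by rewrite -[RHS]map_id; apply: eq_map => -[x b] /=; rewrite hid.
Qed.

Lemma fg_map_comp (X Y Z : choiceType) (h : X -> Y) (k : Y -> Z) (l : X -> Z) :
  (forall x, l x = k (h x)) -> forall a, fg_map l a = fg_map k (fg_map h a).
Proof.
move=> lE a; have [u ->] := wclassP a; rewrite !fg_map_wclass; congr wclass.
by rewrite /word_map -map_comp; apply: eq_map => -[x b] /=; rewrite lE.
Qed.

Definition monotoneb m n (f : {ffun 'I_m.+1 -> 'I_n.+1}) :=
  [forall i : 'I_m.+1, forall j : 'I_m.+1, (i <= j)%N ==> (f i <= f j)%N].

Record delta m n := Delta {
  delta_fun :> {ffun 'I_m.+1 -> 'I_n.+1};
  delta_mono : monotoneb delta_fun
}.

HB.instance Definition _ m n := [isSub for @delta_fun m n].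
HB.instance Definition _ m n := [Finite of delta m n by <:].

Lemma deltaP m n (f g : delta m n) : f =1 g -> f = g.
Proof. by move=> fg; apply/val_inj/ffunP. Qed.

Lemma delta_homo m n (f : delta m n) (i j : 'I_m.+1) : (i <= j)%N -> (f i <= f j)%N.
Proof. by have /forallP/(_ i)/forallP/(_ j)/implyP := delta_mono f. Qed.

Lemma monotonebP m n (f : 'I_m.+1 -> 'I_n.+1) :
  (forall i j : 'I_m.+1, (i <= j)%N -> (f i <= f j)%N) -> monotoneb (finfun f).
Proof.
by move=> fm; apply/forallP=> i; apply/forallP=> j; apply/implyP; rewrite !ffunE; apply: fm.
Qed.

Definition delta_id n : delta n n :=
  Delta (@monotonebP n n id (fun _ _ h => h)).

Lemma delta_comp_mono m n p (f : delta n p) (g : delta m n) (i j : 'I_m.+1) :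
  (i <= j)%N -> ((f \o g) i <= (f \o g) j)%N.
Proof. by move=> ij /=; do 2!apply: delta_homo. Qed.

Definition delta_comp m n p (f : delta n p) (g : delta m n) : delta m p :=
  Delta (monotonebP (delta_comp_mono f g)).

Lemma lift_mono n (i : 'I_n.+2) (j k : 'I_n.+1) :
  (j <= k)%N -> (lift i j <= lift i k)%N.
Proof. by rewrite /= leq_bump2. Qed.

Definition coface n (i : 'I_n.+2) : delta n n.+1 := Delta (monotonebP (@lift_mono n i)).

Definition squash n (i : 'I_n.+1) (j : 'I_n.+2) : 'I_n.+1 := inord (unbump i j).

Lemma squashE n (i : 'I_n.+1) (j : 'I_n.+2) : squash i j = unbump i j :> nat.
Proof.
rewrite inordK // /unbump ltnS leq_subLR; have := ltn_ord j; rewrite ltnS.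
case: (ltnP i j) => /= ij; first by rewrite add1n.
by move=> _; rewrite add0n (leq_trans ij) // -ltnS.
Qed.

Lemma squash_mono n (i : 'I_n.+1) (j k : 'I_n.+2) :
  (j <= k)%N -> (squash i j <= squash i k)%N.
Proof.
move=> jk; rewrite !squashE /unbump.
case: (ltnP i j) => ij; case: (ltnP i k) => ik /=; rewrite ?subn0 ?leq_sub2r //.
- by rewrite leq_subLR (leq_trans jk) ?leqnSn.
- rewrite -ltnS subn1 prednK; last exact: leq_ltn_trans ik.
  exact: leq_ltn_trans ik.
Qed.

Definition codegeneracy n (i : 'I_n.+1) : delta n.+1 n :=
  Delta (monotonebP (@squash_mono n i)).

Lemma delta_idE n i : delta_id n i = i.
Proof. by rewrite ffunE. Qed.

Lemma delta_compE m n p (f : delta n p) (g : delta m n) i :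
  delta_comp f g i = f (g i).
Proof. by rewrite ffunE. Qed.

Lemma cofaceE n (i : 'I_n.+2) j : coface i j = lift i j.
Proof. by rewrite ffunE. Qed.

Lemma codegeneracyE n (i : 'I_n.+1) j : codegeneracy i j = squash i j.
Proof. by rewrite ffunE. Qed.

Record sset := SSet {
  cell :> nat -> choiceType;
  act : forall m n, delta m n -> cell n -> cell m;
  act_id : forall n (x : cell n), act (delta_id n) x = x;
  act_comp : forall m n p (f : delta n p) (g : delta m n) (x : cell p),
    act (delta_comp f g) x = act g (act f x)
}.

Record pointed_sset := PointedSSet {
  psset_sset :> sset;
  base : forall n, psset_sset n;
  act_base : forall m n (f : delta m n), act f (base n) = base m
}.

Record subcomplex (S : sset) := Subcomplex {
  in_subcomplex :> forall n, pred (S n);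
  subcomplex_act : forall m n (f : delta m n) (x : S n),
    in_subcomplex x -> in_subcomplex (act f x)
}.

(* The simplices of S/A are the simplices of S outside A, together with the
   base point [None]. *)
Section Collapse.
Variables (S : sset) (A : subcomplex S).

Definition collapse_cell n : choiceType := option {x : S n | ~~ A n x}.

Definition collapse_act m n (f : delta m n) (u : collapse_cell n) :
  collapse_cell m := obind (fun x => insub (act f (val x))) u.

Lemma collapse_act_id n (u : collapse_cell n) : collapse_act (delta_id n) u = u.
Proof. by case: u => //= x; rewrite act_id valK. Qed.

Lemma collapse_act_comp m n p (f : delta n p) (g : delta m n)
    (u : collapse_cell p) :
  collapse_act (delta_comp f g) u = collapse_act g (collapse_act f u).
Proof.
case: u => //= x; rewrite act_comp; case: (insubP _ (act f (val x))) => [y _ <- //|].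
by rewrite negbK => Afx; rewrite insubF //= subcomplex_act.
Qed.

Definition collapse : pointed_sset :=
  @PointedSSet (SSet collapse_act_id collapse_act_comp) (fun n => None)
    (fun _ _ _ => erefl).

End Collapse.

Section StandardSimplex.
Variable k : nat.

Definition simplex_act m n (f : delta m n) (x : delta n k) : delta m k :=
  delta_comp x f.

Lemma simplex_act_id n (x : delta n k) : simplex_act (delta_id n) x = x.
Proof. by apply: deltaP => i; rewrite delta_compE delta_idE. Qed.

Lemma simplex_act_comp m n p (f : delta n p) (g : delta m n) (x : delta p k) :
  simplex_act (delta_comp f g) x = simplex_act g (simplex_act f x).
Proof. by apply: deltaP => i; rewrite !delta_compE. Qed.

Definition simplex : sset :=
  @SSet (fun n => delta n k) simplex_act simplex_act_id simplex_act_comp.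

(* The boundary is the union of the faces of the standard simplex, so its
   simplices are the maps that miss some vertex. *)
Definition in_boundary n (x : simplex n) : bool :=
  [exists j, j \notin codom (delta_fun x)].

Lemma in_boundary_act m n (f : delta m n) (x : simplex n) :
  in_boundary x -> in_boundary (act f x).
Proof.
case/existsP=> j jx; apply/existsP; exists j; apply: contra jx => /codomP[i ->].
by rewrite delta_compE codom_f.
Qed.

Definition boundary : subcomplex simplex := Subcomplex in_boundary_act.

End StandardSimplex.

Definition simplicial_circle : pointed_sset := collapse (boundary 1).

Record sgroup := SGroup {
  gcell :> nat -> groupType;
  gact : forall m n, delta m n -> gcell n -> gcell m;
  gactM : forall m n (f : delta m n), {morph gact f : x y / x * y};
  gact_id : forall n (x : gcell n), gact (delta_id n) x = x;
  gact_comp : forall m n p (f : delta n p) (g : delta m n) (x : gcell p),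
    gact (delta_comp f g) x = gact g (gact f x)
}.

Section SimplicialGroupTheory.
Variable G : sgroup.

Lemma gact1 m n (f : delta m n) : gact f (1 : G n) = 1.
Proof. by apply: (mulgI (gact f 1)); rewrite -gactM !mulg1. Qed.

Lemma gactV m n (f : delta m n) (x : G n) : gact f x^-1 = (gact f x)^-1.
Proof. by apply: (mulgI (gact f x)); rewrite -gactM !mulgV gact1. Qed.

Lemma gactJ m n (f : delta m n) (x y : G n) : gact f (x ^ y) = gact f x ^ gact f y.
Proof. by rewrite /conjg !gactM gactV. Qed.

Definition face n (i : 'I_n.+2) : G n.+1 -> G n := gact (coface i).

Definition degeneracy n (i : 'I_n.+1) : G n -> G n.+1 := gact (codegeneracy i).

Lemma face1 n (i : 'I_n.+2) : face i 1 = 1. Proof. exact: gact1. Qed.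
Lemma faceM n (i : 'I_n.+2) : {morph face i : x y / x * y}.
Proof. exact: gactM. Qed.
Lemma faceV n (i : 'I_n.+2) : {morph face i : x / x^-1}.
Proof. by move=> x; exact: gactV. Qed.
Lemma degeneracy1 n (i : 'I_n.+1) : degeneracy i 1 = 1. Proof. exact: gact1. Qed.
Lemma degeneracyM n (i : 'I_n.+1) : {morph degeneracy i : x y / x * y}.
Proof. exact: gactM. Qed.

Lemma face_degeneracy_id n (i : 'I_n.+1) (j : 'I_n.+2) (x : G n) :
  (i <= j <= i.+1)%N -> face j (degeneracy i x) = x.
Proof.
move=> ij; rewrite /face /degeneracy -gact_comp -[RHS]gact_id.
congr gact; apply: deltaP => k; rewrite delta_compE codegeneracyE cofaceE delta_idE.
apply: ord_inj; rewrite squashE /= /unbump /bump.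
by have := ltn_ord k; lia.
Qed.

Lemma face_degeneracy_lt n (i : 'I_n.+2) (j : 'I_n.+3) (x : G n.+1) :
  (j < i)%N ->
  face j (degeneracy i x) = degeneracy (inord i.-1) (face (inord j) x).
Proof.
move=> ij; rewrite /face /degeneracy -!gact_comp.
congr gact; apply: deltaP => k; rewrite !delta_compE !codegeneracyE !cofaceE.
apply: ord_inj; rewrite squashE /= squashE /=.
have := ltn_ord i; have := ltn_ord k => kn i_n.
by rewrite !inordK /unbump /bump; lia.
Qed.

Lemma face_degeneracy_gt n (i : 'I_n.+2) (j : 'I_n.+3) (x : G n.+1) :
  (i.+1 < j)%N ->
  face j (degeneracy i x) = degeneracy (inord i) (face (inord j.-1) x).
Proof.
move=> ij; rewrite /face /degeneracy -!gact_comp.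
congr gact; apply: deltaP => k; rewrite !delta_compE !codegeneracyE !cofaceE.
apply: ord_inj; rewrite squashE /= squashE /=.
have := ltn_ord j; have := ltn_ord k => kn j_n.
by rewrite !inordK /unbump /bump; lia.
Qed.

End SimplicialGroupTheory.

Record normal_sub_sgroup (G : sgroup) := NormalSubSGroup {
  nsg_sub :> forall n, normal_subgroup (G n);
  nsg_act : forall m n (f : delta m n) (x : G n),
    nsg_sub n x -> nsg_sub m (gact f x)
}.

Section QuotientSimplicialGroup.
Variables (G : sgroup) (N : normal_sub_sgroup G).

Definition sgquot_cell n : groupType := gquot (coset_congr (N n)).

Definition sgquot_act m n (f : delta m n) (u : sgquot_cell n) : sgquot_cell m :=
  gclass _ (gact f (repr u)).

Lemma sgquot_act_class m n (f : delta m n) (x : G n) :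
  sgquot_act f (gclass _ x) = gclass _ (gact f x).
Proof.
apply/gclass_eq; have := nsg_act f (repr_gclass (coset_congr (N n)) x).
by rewrite gactM gactV.
Qed.

Lemma sgquot_actM m n (f : delta m n) : {morph sgquot_act f : u v / u * v}.
Proof.
move=> u v; have [x ->] := gclassP u; have [y ->] := gclassP v.
by rewrite -gclassM !sgquot_act_class gactM gclassM.
Qed.

Lemma sgquot_act_id n (u : sgquot_cell n) : sgquot_act (delta_id n) u = u.
Proof. by have [x ->] := gclassP u; rewrite sgquot_act_class gact_id. Qed.

Lemma sgquot_act_comp m n p (f : delta n p) (g : delta m n) (u : sgquot_cell p) :
  sgquot_act (delta_comp f g) u = sgquot_act g (sgquot_act f u).
Proof.
by have [x ->] := gclassP u; rewrite !sgquot_act_class gact_comp.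
Qed.

Definition sgquot : sgroup := SGroup sgquot_actM sgquot_act_id sgquot_act_comp.

End QuotientSimplicialGroup.

Section NormalSimplicialClosure.
Variables (G : sgroup) (R : forall n, G n -> Prop).

Inductive simplicial_closure : forall n, G n -> Prop :=
| SClosureGen n (x : G n) of R x : simplicial_closure x
| SClosure1 n : simplicial_closure (1 : G n)
| SClosureM n (x y : G n) of simplicial_closure x & simplicial_closure y :
    simplicial_closure (x * y)
| SClosureV n (x : G n) of simplicial_closure x : simplicial_closure x^-1
| SClosureJ n (x y : G n) of simplicial_closure x : simplicial_closure (x ^ y)
| SClosureAct m n (f : delta m n) (x : G n) of simplicial_closure x :
    simplicial_closure (gact f x).

Definition simplicial_closure_sub : normal_sub_sgroup G :=
  @NormalSubSGroup G
    (fun n => NormalSubgroup (SClosure1 n) (@SClosureM n) (@SClosureV n)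
      (@SClosureJ n)) SClosureAct.

End NormalSimplicialClosure.

(* The homotopy groups, based at 1, of the Kan complex underlying G: a class
   is represented by a simplex all of whose faces are trivial, modulo homotopy
   relative to the boundary. The group law is induced by that of G; the lemmas
   [kan_product_mul] and [kan_productE] below show that it is the usual one,
   defined by extending horns. *)
Section HomotopyGroup.
Variables (G : sgroup) (n : nat).

Definition spherical : G n -> Prop :=
  match n return G n -> Prop with
  | 0 => fun _ => True
  | m.+1 => fun x => forall i : 'I_m.+2, face i x = 1
  end.

Definition homotopic (x y : G n) : Prop :=
  exists w : G n.+1,
    [/\ forall i : 'I_n.+2, (i < n)%N -> face i w = 1,
        face (inord n) w = x & face ord_max w = y].

Definition sphericalb : {pred G n} := fun x => `[< spherical x >].

Lemma spherical_closed : group_closed sphericalb.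
Proof.
split=> [|x y]; rewrite /sphericalb !unfold_in.
  by apply/asboolP; rewrite /spherical; case: (n) => // m i; rewrite face1.
move=> /asboolP xs /asboolP ys; apply/asboolP; move: x y xs ys.
rewrite /spherical; case: (n) => // m x y xs ys i.
by rewrite faceM faceV xs ys mulgV.
Qed.

Record sphere := Sphere { sphere_val :> G n; sphereP : sphericalb sphere_val }.

HB.instance Definition _ := [isSub for sphere_val].
HB.instance Definition _ := [Choice of sphere by <:].
HB.instance Definition _ :=
  SubChoice_isSubGroup.Build (G n) sphericalb sphere spherical_closed.

Lemma face_degeneracy_spherical (x : G n) (i : 'I_n.+1) (j : 'I_n.+2) :
  spherical x ->
  face j (degeneracy i x) = if (i <= j <= i.+1)%N then x else 1.
Proof.
case: ifP => [ij _|ij]; first exact: face_degeneracy_id.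
rewrite /spherical; move: x i j ij.
case: (n) => [|m] x i j ij xs.
  by have := ltn_ord i; have := ltn_ord j; move: ij; lia.
have [ji|ji] := ltnP j i.
  by rewrite face_degeneracy_lt // xs degeneracy1.
by rewrite face_degeneracy_gt ?xs ?degeneracy1 //; move: ij; lia.
Qed.

Lemma sphere_spherical (x : sphere) : spherical x.
Proof. by have /asboolP := sphereP x. Qed.

Lemma sphere_homotopic_refl (x : sphere) : homotopic x x.
Proof.
exists (degeneracy ord_max (sphere_val x)).
split=> [i i_n||]; rewrite face_degeneracy_spherical ?inordK //=;
  try exact: sphere_spherical; by case: ifP => //=; lia.
Qed.

Lemma homotopicM (x x' y y' : G n) :
  homotopic x x' -> homotopic y y' -> homotopic (x * y) (x' * y').
Proof.
case=> [u [u1 <- <-]] [v [v1 <- <-]]; exists (u * v).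
by split=> [i i_n||]; rewrite faceM // u1 // v1 // mulg1.
Qed.

Lemma homotopicV (x y : G n) : homotopic x y -> homotopic x^-1 y^-1.
Proof.
case=> [u [u1 <- <-]]; exists u^-1.
by split=> [i i_n||]; rewrite faceV // u1 // invg1.
Qed.

Definition sphere_homotopic (x y : sphere) : Prop := homotopic x y.

Lemma sphere_homotopic_sym x y : sphere_homotopic x y -> sphere_homotopic y x.
Proof.
rewrite /sphere_homotopic => /homotopicV xy.
have := homotopicM (homotopicM (sphere_homotopic_refl x) xy)
  (sphere_homotopic_refl y).
by rewrite mulgV mul1g mulgVK.
Qed.

Lemma sphere_homotopic_trans x y z :
  sphere_homotopic x y -> sphere_homotopic y z -> sphere_homotopic x z.
Proof.
rewrite /sphere_homotopic => xy yz.
have := homotopicM xy (homotopicM (homotopicV (sphere_homotopic_refl y)) yz).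
by rewrite mulVg mulg1 mulVKg.
Qed.

Lemma sphere_homotopicM x x' y y' :
  sphere_homotopic x x' -> sphere_homotopic y y' ->
  sphere_homotopic (x * y) (x' * y').
Proof. exact: homotopicM. Qed.

Definition homotopy_congr : gcongr sphere :=
  GCongr sphere_homotopic_refl sphere_homotopic_sym sphere_homotopic_trans
    sphere_homotopicM.

Definition homotopy_group : groupType := gquot homotopy_congr.

End HomotopyGroup.

Section KanProduct.
Variables (G : sgroup) (m : nat).

Definition kan_product (x y z : G m.+1) : Prop :=
  exists w : G m.+2,
    [/\ forall i : 'I_m.+3, (i < m)%N -> face i w = 1, face (inord m) w = x,
        face (inord m.+1) w = z & face (inord m.+2) w = y].

Lemma kan_product_mul (x y : sphere G m.+1) : kan_product x y (x * y).
Proof.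
exists (degeneracy (inord m) (sphere_val x) * degeneracy ord_max (sphere_val y)).
have xs := sphere_spherical x; have ys := sphere_spherical y.
split=> [i i_m|||]; rewrite faceM (face_degeneracy_spherical _ _ xs)
  (face_degeneracy_spherical _ _ ys) /= ?inordK; try lia;
  case: ifP; case: ifP; rewrite ?mulg1 ?mul1g //; lia.
Qed.

Lemma kan_productE (x y z : sphere G m.+1) :
  kan_product x y z <->
  gclass (homotopy_congr G m.+1) x * gclass (homotopy_congr G m.+1) y =
  gclass (homotopy_congr G m.+1) z.
Proof.
have max_inord : ord_max = inord m.+2 :> 'I_m.+3.
  by apply: val_inj; rewrite /= inordK.
have ordE (P : 'I_m.+3 -> Prop) : (forall i : 'I_m.+3, (i < m)%N -> P i) ->
    P (inord m) -> forall i : 'I_m.+3, (i < m.+1)%N -> P i.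
  move=> Plt Pm i; rewrite ltnS leq_eqVlt => /orP[/eqP im|/Plt //].
  by rewrite -[i]inord_val im.
have [u [u1 um um1 um2]] := kan_product_mul x y.
rewrite -gclassM; split=> [[w [w1 wm wm1 wm2]]|/gclass_eq].
  apply/gclass_eq; have zxy : homotopic (z^-1 * (x * y)) 1.
    exists (w^-1 * u); split.
    - apply: ordE => [i i_m|]; last by rewrite faceM faceV wm um mulVg.
      by rewrite faceM faceV w1 // u1 // invg1 mulg1.
    - by rewrite faceM faceV wm1 um1.
    - by rewrite max_inord faceM faceV wm2 um2 mulVg.
  by have := homotopicM (sphere_homotopic_refl z) zxy; rewrite mulVKg mulg1.
move=> /sphere_homotopic_sym zxy.
have := homotopicM (sphere_homotopic_refl (x * y)^-1) zxy.
rewrite /= mulVg => -[v [v1 vm vm1]].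
exists (u * v); split=> [i i_m|||]; rewrite faceM.
- by rewrite u1 // v1 ?mulg1 //; lia.
- by rewrite um v1 ?mulg1 // inordK //; lia.
- by rewrite um1 vm mulVKg.
- by rewrite um2 -max_inord vm1 mulg1.
Qed.

End KanProduct.

Section Milnor.
Variable S : pointed_sset.

Definition free_sgroup : sgroup :=
  @SGroup (fun n => free_group (S n)) (fun m n f => fg_map (act f))
    (fun m n f => fg_mapM (act f))
    (fun n => fg_map_id (@act_id S n))
    (fun m n p f g => fg_map_comp (act_comp f g)).

Definition base_rel n (a : free_sgroup n) : Prop := a = fg_gen (base S n).

Lemma base_closure_act m n (f : delta m n) (a : free_sgroup n) :
  normal_closure (@base_rel n) a -> normal_closure (@base_rel m) (gact f a).
Proof.
elim=> [_ ->||b c _ hb _ hc|b _ hb|b c _ hb].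
- by apply: NClosureGen; rewrite /= fg_map_gen act_base.
- by rewrite gact1; apply: NClosure1.
- by rewrite gactM; apply: NClosureM.
- by rewrite gactV; apply: NClosureV.
- by rewrite gactJ; apply: NClosureJ.
Qed.

Definition base_closure : normal_sub_sgroup free_sgroup :=
  @NormalSubSGroup free_sgroup
    (fun n => normal_closure_subgroup (@base_rel n)) base_closure_act.

Definition milnor : sgroup := sgquot base_closure.

Definition milnor_gen n (x : S n) : milnor n :=
  gclass (coset_congr (base_closure n)) (fg_gen x).

Definition repeated_commutator n (a : milnor n) : Prop :=
  exists (x : S n) (s : seq (S n)),
    ~~ uniq (x :: s) /\
    a = foldl (fun u y => [~ u, milnor_gen y]) (milnor_gen x) s.

Definition cohen : sgroup :=
  sgquot (simplicial_closure_sub (@repeated_commutator)).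

End Milnor.

Local Open Scope ring_scope.

(* A Lie ring is a Lie algebra over the integers. *)
HB.mixin Record Zmodule_isLieRing V of GRing.Zmodule V := {
  lbr : V -> V -> V;
  lbrDl : forall x y z, lbr (x + y) z = lbr x z + lbr y z;
  lbrDr : forall x y z, lbr x (y + z) = lbr x y + lbr x z;
  lbrxx : forall x, lbr x x = 0;
  lbr_jacobi : forall x y z,
    lbr (lbr x y) z + lbr (lbr y z) x + lbr (lbr z x) y = 0
}.

#[short(type="lieRingType")]
HB.structure Definition LieRing :=
  {V of Zmodule_isLieRing V & GRing.Zmodule V}.

Section FreeLie.
Variable X : choiceType.

Inductive lterm :=
| LVar of X
| LZero
| LAdd of lterm & lterm
| LOpp of lterm
| LBr of lterm & lterm.

HB.instance Definition _ := gen_eqMixin lterm.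
HB.instance Definition _ := gen_choiceMixin lterm.

Inductive lie_eq : lterm -> lterm -> Prop :=
| LieRefl a : lie_eq a a
| LieSym a b of lie_eq a b : lie_eq b a
| LieTrans a b c of lie_eq a b & lie_eq b c : lie_eq a c
| LieAddCong a a' b b' of lie_eq a a' & lie_eq b b' :
    lie_eq (LAdd a b) (LAdd a' b')
| LieOppCong a a' of lie_eq a a' : lie_eq (LOpp a) (LOpp a')
| LieBrCong a a' b b' of lie_eq a a' & lie_eq b b' :
    lie_eq (LBr a b) (LBr a' b')
| LieAddA a b c : lie_eq (LAdd a (LAdd b c)) (LAdd (LAdd a b) c)
| LieAddC a b : lie_eq (LAdd a b) (LAdd b a)
| LieAdd0 a : lie_eq (LAdd LZero a) a
| LieAddN a : lie_eq (LAdd (LOpp a) a) LZero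
| LieBrDl a b c : lie_eq (LBr (LAdd a b) c) (LAdd (LBr a c) (LBr b c))
| LieBrDr a b c : lie_eq (LBr a (LAdd b c)) (LAdd (LBr a b) (LBr a c))
| LieBrxx a : lie_eq (LBr a a) LZero
| LieJacobi a b c :
    lie_eq (LAdd (LAdd (LBr (LBr a b) c) (LBr (LBr b c) a)) (LBr (LBr c a) b))
      LZero.

Definition lie_eqb : rel lterm := fun a b => `[< lie_eq a b >].

Lemma lie_eqb_refl : reflexive lie_eqb.
Proof. by move=> a; apply/asboolP; apply: LieRefl. Qed.

Lemma lie_eqb_sym : symmetric lie_eqb.
Proof. by move=> a b; apply/asboolP/asboolP; apply: LieSym. Qed.

Lemma lie_eqb_trans : transitive lie_eqb.
Proof.
by move=> b a c /asboolP ab /asboolP bc; apply/asboolP; apply: LieTrans ab bc.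
Qed.

Canonical lie_equiv := EquivRel lie_eqb lie_eqb_refl lie_eqb_sym lie_eqb_trans.

Definition free_lie := {eq_quot lie_equiv}.

HB.instance Definition _ := Choice.on free_lie.
HB.instance Definition _ := EqQuotient.on free_lie.

Definition lclass (a : lterm) : free_lie := \pi_free_lie a.

Lemma lclass_eq a b : lclass a = lclass b <-> lie_eq a b.
Proof.
split=> [/eqP|ab]; first by rewrite /lclass eqmodE => /asboolP.
by apply/eqP; rewrite /lclass eqmodE; apply/asboolP.
Qed.

Lemma lclass_repr (u : free_lie) : lclass (repr u) = u.
Proof. exact: reprK. Qed.

Lemma lclassP (u : free_lie) : exists a, u = lclass a.
Proof. by exists (repr u); rewrite lclass_repr. Qed.

Lemma repr_lclass a : lie_eq (repr (lclass a)) a.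
Proof. by apply/lclass_eq; rewrite lclass_repr. Qed.

Definition fl_zero : free_lie := lclass LZero.
Definition fl_add (u v : free_lie) : free_lie := lclass (LAdd (repr u) (repr v)).
Definition fl_opp (u : free_lie) : free_lie := lclass (LOpp (repr u)).
Definition fl_br (u v : free_lie) : free_lie := lclass (LBr (repr u) (repr v)).

Lemma lclass_add a b : fl_add (lclass a) (lclass b) = lclass (LAdd a b).
Proof. by apply/lclass_eq/LieAddCong; apply: repr_lclass. Qed.

Lemma lclass_opp a : fl_opp (lclass a) = lclass (LOpp a).
Proof. by apply/lclass_eq/LieOppCong/repr_lclass. Qed.

Lemma lclass_br a b : fl_br (lclass a) (lclass b) = lclass (LBr a b).
Proof. by apply/lclass_eq/LieBrCong; apply: repr_lclass. Qed.

Lemma fl_addA : associative fl_add.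
Proof.
move=> u v w; have [a ->] := lclassP u; have [b ->] := lclassP v.
have [c ->] := lclassP w; rewrite !lclass_add.
by apply/lclass_eq; apply: LieAddA.
Qed.

Lemma fl_addC : commutative fl_add.
Proof.
move=> u v; have [a ->] := lclassP u; have [b ->] := lclassP v.
by rewrite !lclass_add; apply/lclass_eq; apply: LieAddC.
Qed.

Lemma fl_add0 : left_id fl_zero fl_add.
Proof.
move=> u; have [a ->] := lclassP u.
by rewrite lclass_add; apply/lclass_eq; apply: LieAdd0.
Qed.

Lemma fl_addN : left_inverse fl_zero fl_opp fl_add.
Proof.
move=> u; have [a ->] := lclassP u.
by rewrite lclass_opp lclass_add; apply/lclass_eq; apply: LieAddN.
Qed.

HB.instance Definition _ := GRing.isZmodule.Build free_lie
  fl_addA fl_addC fl_add0 fl_addN.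

Lemma lclassD a b : lclass (LAdd a b) = lclass a + lclass b.
Proof. by rewrite -[LHS]lclass_add. Qed.

Lemma lclassN a : lclass (LOpp a) = - lclass a.
Proof. by rewrite -[LHS]lclass_opp. Qed.

Lemma fl_brDl u v w : fl_br (u + v) w = fl_br u w + fl_br v w.
Proof.
have [a ->] := lclassP u; have [b ->] := lclassP v; have [c ->] := lclassP w.
rewrite -lclassD !lclass_br -lclassD.
by apply/lclass_eq; apply: LieBrDl.
Qed.

Lemma fl_brDr u v w : fl_br u (v + w) = fl_br u v + fl_br u w.
Proof.
have [a ->] := lclassP u; have [b ->] := lclassP v; have [c ->] := lclassP w.
rewrite -lclassD !lclass_br -lclassD.
by apply/lclass_eq; apply: LieBrDr.
Qed.

Lemma fl_brxx u : fl_br u u = 0.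
Proof.
have [a ->] := lclassP u; rewrite lclass_br.
by apply/lclass_eq; apply: LieBrxx.
Qed.

Lemma fl_jacobi u v w :
  fl_br (fl_br u v) w + fl_br (fl_br v w) u + fl_br (fl_br w u) v = 0.
Proof.
have [a ->] := lclassP u; have [b ->] := lclassP v; have [c ->] := lclassP w.
rewrite !lclass_br -!lclassD.
by apply/lclass_eq; apply: LieJacobi.
Qed.

HB.instance Definition _ := Zmodule_isLieRing.Build free_lie
  fl_brDl fl_brDr fl_brxx fl_jacobi.

Definition lie_gen (x : X) : free_lie := lclass (LVar x).

End FreeLie.

Record lie_ideal (L : lieRingType) := LieIdeal {
  in_lie_ideal :> L -> Prop;
  lie_ideal0 : in_lie_ideal 0;
  lie_idealD : forall x y, in_lie_ideal x -> in_lie_ideal y -> in_lie_ideal (x + y);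
  lie_idealN : forall x, in_lie_ideal x -> in_lie_ideal (- x);
  lie_ideal_brl : forall x y, in_lie_ideal x -> in_lie_ideal (lbr x y);
  lie_ideal_brr : forall x y, in_lie_ideal y -> in_lie_ideal (lbr x y)
}.

Section QuotientLieRing.
Variables (L : lieRingType) (I : lie_ideal L).

Definition lie_mod : rel L := fun x y => `[< I (x - y) >].

Lemma lie_mod_refl : reflexive lie_mod.
Proof. by move=> x; apply/asboolP; rewrite subrr; apply: lie_ideal0. Qed.

Lemma lie_mod_sym : symmetric lie_mod.
Proof.
by move=> x y; apply/asboolP/asboolP => /lie_idealN; rewrite opprB.
Qed.

Lemma lie_mod_trans : transitive lie_mod.
Proof.
move=> y x z /asboolP xy /asboolP yz; apply/asboolP.
by have := lie_idealD xy yz; rewrite addrA subrK.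
Qed.

Canonical lie_mod_equiv := EquivRel lie_mod lie_mod_refl lie_mod_sym lie_mod_trans.

Definition lie_quot := {eq_quot lie_mod_equiv}.

HB.instance Definition _ := Choice.on lie_quot.
HB.instance Definition _ := EqQuotient.on lie_quot.

Definition lie_class (x : L) : lie_quot := \pi_lie_quot x.

Lemma lie_class_eq x y : lie_class x = lie_class y <-> I (x - y).
Proof.
split=> [/eqP|xy]; first by rewrite /lie_class eqmodE => /asboolP.
by apply/eqP; rewrite /lie_class eqmodE; apply/asboolP.
Qed.

Lemma lie_class_repr (u : lie_quot) : lie_class (repr u) = u.
Proof. exact: reprK. Qed.

Lemma lie_classP (u : lie_quot) : exists x, u = lie_class x.
Proof. by exists (repr u); rewrite lie_class_repr. Qed.

Lemma repr_lie_class x : I (repr (lie_class x) - x).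
Proof. by apply/lie_class_eq; rewrite lie_class_repr. Qed.

Definition lq_zero : lie_quot := lie_class 0.
Definition lq_add (u v : lie_quot) : lie_quot := lie_class (repr u + repr v).
Definition lq_opp (u : lie_quot) : lie_quot := lie_class (- repr u).
Definition lq_br (u v : lie_quot) : lie_quot := lie_class (lbr (repr u) (repr v)).

Lemma lie_class_add x y : lq_add (lie_class x) (lie_class y) = lie_class (x + y).
Proof.
apply/lie_class_eq; rewrite opprD addrACA.
by apply: lie_idealD; apply: repr_lie_class.
Qed.

Lemma lie_class_opp x : lq_opp (lie_class x) = lie_class (- x).
Proof.
apply/lie_class_eq; rewrite -opprD.
by apply/lie_idealN/repr_lie_class.
Qed.

Lemma lbr0x (x : L) : lbr 0 x = 0.
Proof. by apply: (addrI (lbr 0 x)); rewrite -lbrDl !addr0. Qed.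

Lemma lbrx0 (x : L) : lbr x 0 = 0.
Proof. by apply: (addrI (lbr x 0)); rewrite -lbrDr !addr0. Qed.

Lemma lbrNl (x y : L) : lbr (- x) y = - lbr x y.
Proof. by apply: (addrI (lbr x y)); rewrite -lbrDl !subrr lbr0x. Qed.

Lemma lbrNr (x y : L) : lbr x (- y) = - lbr x y.
Proof. by apply: (addrI (lbr x y)); rewrite -lbrDr !subrr lbrx0. Qed.

Lemma lie_class_br x y : lq_br (lie_class x) (lie_class y) = lie_class (lbr x y).
Proof.
apply/lie_class_eq; set x' := repr _; set y' := repr _.
have -> : lbr x' y' - lbr x y = lbr (x' - x) y' + lbr x (y' - y).
  by rewrite lbrDl lbrDr lbrNl lbrNr addrA subrK.
apply: lie_idealD; [apply: lie_ideal_brl | apply: lie_ideal_brr];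
  exact: repr_lie_class.
Qed.

Lemma lq_addA : associative lq_add.
Proof.
move=> u v w; have [x ->] := lie_classP u; have [y ->] := lie_classP v.
by have [z ->] := lie_classP w; rewrite !lie_class_add addrA.
Qed.

Lemma lq_addC : commutative lq_add.
Proof.
move=> u v; have [x ->] := lie_classP u; have [y ->] := lie_classP v.
by rewrite !lie_class_add addrC.
Qed.

Lemma lq_add0 : left_id lq_zero lq_add.
Proof. by move=> u; have [x ->] := lie_classP u; rewrite lie_class_add add0r. Qed.

Lemma lq_addN : left_inverse lq_zero lq_opp lq_add.
Proof.
move=> u; have [x ->] := lie_classP u.
by rewrite lie_class_opp lie_class_add addNr.
Qed.

HB.instance Definition _ := GRing.isZmodule.Build lie_quot
  lq_addA lq_addC lq_add0 lq_addN.

Lemma lie_classD x y : lie_class (x + y) = lie_class x + lie_class y.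
Proof. by rewrite -[LHS]lie_class_add. Qed.

Lemma lie_classN x : lie_class (- x) = - lie_class x.
Proof. by rewrite -[LHS]lie_class_opp. Qed.

Lemma lie_class0 : lie_class 0 = 0. Proof. by []. Qed.

Lemma lq_brDl u v w : lq_br (u + v) w = lq_br u w + lq_br v w.
Proof.
have [x ->] := lie_classP u; have [y ->] := lie_classP v.
have [z ->] := lie_classP w.
by rewrite -lie_classD !lie_class_br lbrDl lie_classD.
Qed.

Lemma lq_brDr u v w : lq_br u (v + w) = lq_br u v + lq_br u w.
Proof.
have [x ->] := lie_classP u; have [y ->] := lie_classP v.
have [z ->] := lie_classP w.
by rewrite -lie_classD !lie_class_br lbrDr lie_classD.
Qed.

Lemma lq_brxx u : lq_br u u = 0.
Proof. by have [x ->] := lie_classP u; rewrite lie_class_br lbrxx. Qed.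

Lemma lq_jacobi u v w :
  lq_br (lq_br u v) w + lq_br (lq_br v w) u + lq_br (lq_br w u) v = 0.
Proof.
have [x ->] := lie_classP u; have [y ->] := lie_classP v.
have [z ->] := lie_classP w.
by rewrite !lie_class_br -!lie_classD lbr_jacobi.
Qed.

HB.instance Definition _ := Zmodule_isLieRing.Build lie_quot
  lq_brDl lq_brDr lq_brxx lq_jacobi.

End QuotientLieRing.

Inductive ideal_closure (L : lieRingType) (R : L -> Prop) : L -> Prop :=
| IClosureGen x of R x : ideal_closure R x
| IClosure0 : ideal_closure R 0
| IClosureD x y of ideal_closure R x & ideal_closure R y :
    ideal_closure R (x + y)
| IClosureN x of ideal_closure R x : ideal_closure R (- x)
| IClosureBrl x y of ideal_closure R x : ideal_closure R (lbr x y)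
| IClosureBrr x y of ideal_closure R y : ideal_closure R (lbr x y).

Definition generated_lie_ideal (L : lieRingType) (R : L -> Prop) : lie_ideal L :=
  LieIdeal (IClosure0 R) (@IClosureD L R) (@IClosureN L R) (@IClosureBrl L R)
    (@IClosureBrr L R).

Section LieAlgebra.
Variable n : nat.

Definition repeated_lie_element (u : free_lie 'I_n) : Prop :=
  exists (i : 'I_n) (s : seq 'I_n),
    ~~ uniq (i :: s) /\
    u = foldl (fun v j => lbr v (lie_gen j)) (lie_gen i) s.

Definition Lie_algebra : lieRingType :=
  lie_quot (generated_lie_ideal repeated_lie_element).

Definition Lie_gen (i : 'I_n) : Lie_algebra := lie_class _ (lie_gen i).

Inductive lie_monomial : nat -> Lie_algebra -> Prop :=
| LieMonomialGen i : lie_monomial 1 (Lie_gen i)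
| LieMonomialBr a b u v of lie_monomial a u & lie_monomial b v :
    lie_monomial (a + b) (lbr u v).

Inductive of_weight (k : nat) : Lie_algebra -> Prop :=
| WeightMonomial u of lie_monomial k u : of_weight k u
| Weight0 : of_weight k 0
| WeightD u v of of_weight k u & of_weight k v : of_weight k (u + v)
| WeightN u of of_weight k u : of_weight k (- u).

Definition weight_nb : {pred Lie_algebra} := fun u => `[< of_weight n u >].

Lemma weight_nb_closed : zmod_closed weight_nb.
Proof.
split=> [|u v]; rewrite !unfold_in; first by apply/asboolP; apply: Weight0.
move=> /asboolP un /asboolP vn; apply/asboolP.
by apply: WeightD => //; apply: WeightN.
Qed.

HB.instance Definition _ :=
  GRing.isZmodClosed.Build Lie_algebra weight_nb weight_nb_closed.

Record Lie := LieElement { Lie_val :> Lie_algebra; LieP : weight_nb Lie_val }.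

HB.instance Definition _ := [isSub for Lie_val].
HB.instance Definition _ := [Choice of Lie by <:].
HB.instance Definition _ := [SubChoice_isSubZmodule of Lie by <:].

End LieAlgebra.

(* Main.v *)
(* Let x_0, ..., x_m be the generators of K(S^1)_{m+1}. The last face kills x_m,
   and its kernel H is abelian, generated by the left-normed commutators
   [[x_m, x_w1], ..., x_wt]; repeated letters make them trivial. Letting x_j act
   by right multiplication by 1 + x_j on noncommutative polynomials modulo words
   with repeated letters shows that those given by words w without repetition
   form a basis of H. In coordinates the face d_k identifies the letters k - 1
   and k (d_0 kills the letter 0), so an element of H killed by d_0, ..., d_{m-1}
   only involves the words using all of the letters 0, ..., m - 1, and these are
   killed by every face. Hence homotopic spheres are equal, and the group of
   spheres is free abelian on the permutations of 0, ..., m - 1. By the same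
   argument, with x_j acting by right multiplication by x_j, so is Lie(m+1), on
   the brackets [[x_m, x_w1], ..., x_wm]. *)
Require Import Defs.
From HB Require Import structures.
From mathcomp Require Import all_boot ssralg ssrint.
From mathcomp Require Import boolp functions zify.

Set Implicit Arguments.
Unset Strict Implicit.
Unset Printing Implicit Defensive.

Import GRing.Theory.

Local Open Scope ring_scope.

(** * Integral combinations *)

Section IntegerCombinations.
Variables (I : eqType) (r : seq I) (U : zmodType) (F : I -> U).

Definition intcomb (a : I -> int) : U := \sum_(i <- r) F i *~ a i.

Definition intspan (u : U) : Prop := exists a, u = intcomb a.

Lemma intcombD a b : intcomb (fun i => a i + b i) = intcomb a + intcomb b.
Proof. by rewrite -big_split; apply: eq_bigr => i _; rewrite mulrzDr. Qed.

Lemma intcomb_ind (P : U -> Prop) a :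
  P 0 -> (forall x y, P x -> P y -> P (x + y)) -> (forall x, P x -> P (- x)) ->
  {in r, forall i, P (F i)} -> P (intcomb a).
Proof.
move=> P0 PD PN PF; have PMn x k : P x -> P (x *+ k).
  by move=> Px; elim: k => [|k IHk]; rewrite ?mulr0n // mulrS; apply: PD.
rewrite /intcomb big_seq; apply: big_ind => // i ir.
case: (a i) => k; rewrite ?NegzE ?mulrNz -?pmulrn; first exact/PMn/PF.
exact/PN/PMn/PF.
Qed.

Lemma intspan0 : intspan 0.
Proof. by exists (fun=> 0); rewrite /intcomb big1 // => i _; rewrite mulr0z. Qed.

Lemma intspanD u v : intspan u -> intspan v -> intspan (u + v).
Proof. by move=> [a ->] [b ->]; exists (fun i => a i + b i); rewrite intcombD. Qed.

Lemma intspanN u : intspan u -> intspan (- u).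
Proof.
move=> [a ->]; exists (fun i => - a i).
by rewrite /intcomb -sumrN; apply: eq_bigr => i _; rewrite mulrNz.
Qed.

Hypothesis r_uniq : uniq r.

Lemma intspan_gen i : i \in r -> intspan (F i).
Proof.
move=> ir; exists (fun j => (j == i)%:R); rewrite /intcomb (bigD1_seq i) //= eqxx.
by rewrite big1 ?addr0 // => j /negPf ->; rewrite mulr0z.
Qed.

Lemma additive_intcomb (V : zmodType) (phi : U -> V) a :
  {morph phi : x y / x + y} ->
  phi (intcomb a) = \sum_(i <- r) phi (F i) *~ a i.
Proof.
move=> phiD; have phi0 : phi 0 = 0.
  by apply: (addrI (phi 0)); rewrite -phiD !addr0.
have phiN x : phi (- x) = - phi x.
  by apply: (addrI (phi x)); rewrite -phiD !subrr.
have phiMn x k : phi (x *+ k) = phi x *+ k.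
  by elim: k => [|k IHk]; rewrite ?mulr0n // !mulrS phiD IHk.
rewrite /intcomb (big_morph phi phiD phi0); apply: eq_bigr => i _.
by case: (a i) => k /=; rewrite ?NegzE ?mulrNz ?phiN -!pmulrn phiMn.
Qed.

(** Gives the linear independence of the commutators and of the brackets, with [phi] reading off the
    coefficient of a word. *)
Lemma dual_intcomb (phi : U -> int) a i :
  {morph phi : x y / x + y} -> i \in r ->
  {in r, forall j, phi (F j) = (i == j)%:R} -> phi (intcomb a) = a i.
Proof.
move=> phiD ir phiF; rewrite additive_intcomb // (bigD1_seq i) //= phiF // eqxx intz.
rewrite big1_seq ?addr0 // => j /andP[ji jr].
by rewrite phiF // eq_sym (negPf ji) mul0rz.
Qed.

End IntegerCombinations.

(** * Additive right actions of groups *)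

Record raction (G : groupType) (V : zmodType) := RAction {
  ract :> V -> G -> V;
  ractD : forall g, {morph ract^~ g : c d / c + d};
  ract_mul1 : forall c, ract c 1%g = c;
  ractM : forall c g h, ract c (g * h)%g = ract (ract c g) h
}.

Section RightActionTheory.
Variables (G : groupType) (V : zmodType) (A : raction G V).

Lemma ract0 g : A 0 g = 0.
Proof. by apply: (addrI (A 0 g)); rewrite -ractD !addr0. Qed.

Lemma ractN g c : A (- c) g = - A c g.
Proof. by apply: (addrI (A c g)); rewrite -ractD !subrr ract0. Qed.

Lemma ractK g c : A (A c g) g^-1%g = c.
Proof. by rewrite -ractM mulgV ract_mul1. Qed.

Lemma ractVK g c : A (A c g^-1%g) g = c.
Proof. by rewrite -ractM mulVg ract_mul1. Qed.

Definition acts_trivially g := forall c, A c g = c.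

Lemma acts_trivially1 : acts_trivially 1%g.
Proof. exact: ract_mul1. Qed.

Lemma acts_triviallyM g h :
  acts_trivially g -> acts_trivially h -> acts_trivially (g * h)%g.
Proof. by move=> g1 h1 c; rewrite ractM g1 h1. Qed.

Lemma acts_triviallyV g : acts_trivially g -> acts_trivially g^-1%g.
Proof. by move=> g1 c; rewrite -{1}(g1 c) ractK. Qed.

Lemma acts_triviallyJ g h : acts_trivially g -> acts_trivially (g ^ h)%g.
Proof. by move=> g1 c; rewrite conjgE !ractM g1 ractVK. Qed.

Lemma acts_trivially_closure (R : G -> Prop) g :
  (forall x, R x -> acts_trivially x) -> normal_closure R g -> acts_trivially g.
Proof.
move=> R1; elim=> [x /R1 //||x y _ hx _ hy|x _ hx|x y _ hx].
- exact: acts_trivially1.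
- exact: acts_triviallyM.
- exact: acts_triviallyV.
- exact: acts_triviallyJ.
Qed.

(** [g] acts as 1 + n, where n has its image in [J] and vanishes on [J]. The product of two such
    parts n is 0, so composing operators adds these parts. For [J] stable under the group, such
    elements are closed under products, inverses and conjugation. *)
Definition unipotent (J : V -> Prop) g :=
  (forall c, J (A c g - c)) /\ (forall c, J c -> A c g = c).

Variable J : V -> Prop.
Hypothesis JD : forall c d, J c -> J d -> J (c + d).
Hypothesis JN : forall c, J c -> J (- c).
Hypothesis JA : forall g c, J c -> J (A c g).

Lemma unipotentM g h : unipotent J g -> unipotent J h -> unipotent J (g * h)%g.
Proof.
move=> [g1 g2] [h1 h2]; split=> [c|c Jc]; rewrite ractM; last by rewrite g2 // h2.
rewrite -(subrK (A c g) (A _ h)) -addrA; exact: JD.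
Qed.

Lemma unipotentV g : unipotent J g -> unipotent J g^-1%g.
Proof.
move=> [g1 g2]; split=> [c|c Jc]; last by rewrite -{1}(g2 c Jc) ractK.
by have := JN (g1 (A c g^-1%g)); rewrite ractVK opprB.
Qed.

Lemma unipotentJ g h : unipotent J g -> unipotent J (g ^ h)%g.
Proof.
move=> [g1 g2]; split=> [c|c Jc]; rewrite conjgE !ractM.
  by rewrite -{2}(ractVK h c) -ractN -ractD; apply/JA/g1.
by rewrite g2 ?ractVK //; apply: JA.
Qed.

Lemma unipotentR g h : unipotent J g -> unipotent J [~ g, h]%g.
Proof.
by move=> ug; rewrite commgEl; apply: unipotentM (unipotentV ug) (unipotentJ h ug).
Qed.

Lemma unipotentMD g h c : unipotent J g -> unipotent J h ->
  A c (g * h)%g - c = (A c g - c) + (A c h - c).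
Proof.
move=> [g1 _] [_ h2]; rewrite ractM -{1}(subrK c (A c g)) ractD h2 //.
by rewrite addrA.
Qed.

Lemma unipotent_comm g h :
  unipotent J g -> unipotent J h -> acts_trivially [~ g, h]%g.
Proof.
move=> ug uh c; have gh d : A d (g * h)%g = A d (h * g)%g.
  by apply: (addIr (- d)); rewrite !unipotentMD // addrC.
(* The commutator is (h g)^-1 (g h), and the two products act alike. *)
by rewrite commgEl conjgE mulgA -invgM ractM gh ractVK.
Qed.

End RightActionTheory.

(** * Actions of quotients and of free groups *)

Section ActionOfQuotient.
Variables (G : groupType) (V : zmodType) (N : normal_subgroup G).
Variable A : raction G V.
Hypothesis N1 : forall g, N g -> acts_trivially A g.

Let Q : groupType := gquot (coset_congr N).

Definition quot_act (c : V) (u : Q) : V := A c (repr u).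

Lemma quot_act_class c g : quot_act c (gclass (coset_congr N) g) = A c g.
Proof.
have /N1 := repr_gclass (coset_congr N) g; rewrite /quot_act.
by set h := repr _ => /(_ (A c h)); rewrite -ractM mulVKg.
Qed.

Lemma quot_actD u : {morph quot_act^~ u : c d / c + d}.
Proof. by move=> c d; apply: ractD. Qed.

Lemma quot_act1 c : quot_act c 1%g = c.
Proof. by rewrite -[1%g]gclass1 quot_act_class ract_mul1. Qed.

Lemma quot_actM c u v : quot_act c (u * v)%g = quot_act (quot_act c u) v.
Proof.
have [x ->] := gclassP u; have [y ->] := gclassP v.
by rewrite -gclassM !quot_act_class ractM.
Qed.

Definition quot_raction : raction Q V := RAction quot_actD quot_act1 quot_actM.

End ActionOfQuotient.

Section ActionOfFreeGroup.
Variables (X : choiceType) (V : zmodType) (N : X -> V -> V).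
Hypothesis ND : forall x, {morph N x : c d / c + d}.
Hypothesis NN : forall x c, N x (N x c) = 0.

Definition letter_act (c : V) (p : X * bool) : V :=
  if p.2 then c - N p.1 c else c + N p.1 c.

Let N0 x : N x 0 = 0.
Proof. by apply: (addrI (N x 0)); rewrite -ND !addr0. Qed.

Let NB x c : N x (- c) = - N x c.
Proof. by apply: (addrI (N x c)); rewrite -ND !subrr N0. Qed.

Lemma letter_actD p : {morph letter_act^~ p : c d / c + d}.
Proof.
by move=> c d; rewrite /letter_act ND; case: p.2; rewrite ?opprD addrACA.
Qed.

(** Since [N x] has square zero, 1 + [N x] and 1 - [N x] are inverse to each other. *)
Lemma letter_actK c x b : letter_act (letter_act c (x, b)) (x, ~~ b) = c.
Proof.
by case: b; rewrite /letter_act /= ND ?NB NN ?oppr0 addr0 ?addrK ?subrK.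
Qed.

Definition word_act (c : V) (u : word X) : V := foldl letter_act c u.

Lemma word_actD u : {morph word_act^~ u : c d / c + d}.
Proof.
by elim: u => [//|p u IHu] c d; rewrite /= letter_actD; apply: IHu.
Qed.

Lemma word_act_eq u v c : word_eq u v -> word_act c u = word_act c v.
Proof.
move=> uv; elim: uv c => [//|w w' _ h|w w' w'' _ h _ h'|w w' t t' _ h _ h'|x b] c.
- by rewrite h.
- by rewrite h.
- by rewrite /word_act !foldl_cat -!/(word_act _ _) h h'.
- exact: letter_actK.
Qed.

Definition free_act (c : V) (g : free_group X) : V := word_act c (repr g).

Lemma free_act_class c u : free_act c (wclass u) = word_act c u.
Proof. exact/word_act_eq/repr_wclass. Qed.

Lemma free_actD g : {morph free_act^~ g : c d / c + d}.
Proof. exact: word_actD. Qed.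

Lemma free_act1 c : free_act c 1%g = c.
Proof. exact: (free_act_class c [::]). Qed.

Lemma free_actM c g h : free_act c (g * h)%g = free_act (free_act c g) h.
Proof.
have [u ->] := wclassP g; have [v ->] := wclassP h.
by rewrite -wclassM !free_act_class /word_act foldl_cat.
Qed.

Definition free_raction : raction (free_group X) V :=
  RAction free_actD free_act1 free_actM.

Lemma free_act_gen c x : free_act c (fg_gen x) = c + N x c.
Proof. exact: free_act_class. Qed.

Lemma free_act_stable (J : V -> Prop) g c :
  (forall c d, J c -> J d -> J (c + d)) -> (forall c, J c -> J (- c)) ->
  (forall x c, J c -> J (N x c)) -> J c -> J (free_act c g).
Proof.
move=> JD JN JX; have [u ->] := wclassP g; rewrite free_act_class.
elim: u c => [//|p u IHu] c Jc /=; apply: IHu; rewrite /letter_act.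
by case: p.2; apply: JD => //; try apply: JN; apply: JX.
Qed.

End ActionOfFreeGroup.

(** * The representation on words without repetition *)

Local Notation wordfun := (seq nat -> int).

(* Right multiplication by the letter j on the span of the words without
   repetition in the letters 0, ..., m that are empty or start with m: a product
   leaving this set is 0. A word is stored as the list of its letters from right
   to left. *)
Definition append (m j : nat) (c : wordfun) : wordfun := fun w =>
  if w is k :: v then
    if [&& k == j, (j <= m)%N, j \notin v & (v == [::]) ==> (j == m)] then c v
    else 0
  else 0.

Definition word_ind (w : seq nat) : wordfun := fun v => (v == w)%:R.

(** The combinations of words that contain [y]. This is the [J] for which the generator of letter
    [y] is unipotent: appending [y] lands in it and vanishes on it. *)
Definition supp_has (y : nat) (c : wordfun) : Prop :=
  forall w, y \notin w -> c w = 0.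

Lemma appendD m j : {morph append m j : c d / c + d}.
Proof.
move=> c d; apply/funext => -[|k v]; rewrite !addrfctE /= ?addr0 //.
by case: ifP; rewrite ?addr0.
Qed.

Lemma append_square m j c : append m j (append m j c) = 0.
Proof.
apply/funext => -[|k [|l v]] //=; case: ifP => // /and4P[_ _ jv _].
by case: ifP => // /andP[/eqP lj _]; rewrite lj inE eqxx in jv.
Qed.

(** The letter m + 1 will stand for the base point, which has to act trivially. *)
Lemma append_gt m j c : (m < j)%N -> append m j c = 0.
Proof.
by move=> mj; apply/funext => -[|k v] //=; rewrite leqNgt mj andbF.
Qed.

Lemma append_word m j w :
  append m j (word_ind w) =
  if [&& (j <= m)%N, j \notin w & (w == [::]) ==> (j == m)] then
    word_ind (j :: w) else 0.
Proof.
apply/funext => -[|k v]; rewrite /append /word_ind; first by case: ifP.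
have [->|kj] := eqVneq k j => /=; last first.
  by case: ifP => // _; rewrite eqseq_cons (negPf kj).
have [->|vw] := eqVneq v w; first by case: ifP => //; rewrite eqxx.
by do 2!case: ifP => //; rewrite eqseq_cons (negPf vw) andbF.
Qed.

Lemma append0 m j : append m j 0 = 0.
Proof. by apply/funext => -[|k v] //=; case: ifP. Qed.

Lemma supp_hasD y c d : supp_has y c -> supp_has y d -> supp_has y (c + d).
Proof. by move=> cy dy w yw; rewrite [LHS]/(_ + _) cy // dy // addr0. Qed.

Lemma supp_hasN y c : supp_has y c -> supp_has y (- c).
Proof. by move=> cy w yw; rewrite [LHS]/(- _) cy // oppr0. Qed.

Lemma supp_has_append y m j c : supp_has y c -> supp_has y (append m j c).
Proof.
move=> cy [|k v] //= yv; case: ifP => // _.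
by apply: cy; move: yv; rewrite inE negb_or => /andP[].
Qed.

Lemma append_supp_has m j c : supp_has j (append m j c).
Proof.
by move=> [|k v] //= jv; case: ifP => // /andP[/eqP kj _]; rewrite kj inE eqxx in jv.
Qed.

Lemma append_has0 m j c : supp_has j c -> append m j c = 0.
Proof.
move=> cj; apply/funext => -[|k v] //=.
by case: ifP => // /and4P[_ _ jv _]; rewrite cj.
Qed.

(** * Simplices of the circle *)

Definition step_fun n k (i : 'I_n.+1) : 'I_2 :=
  if (k < i)%N then ord_max else ord0.

Lemma step_mono n k (i j : 'I_n.+1) :
  (i <= j)%N -> (step_fun k i <= step_fun k j)%N.
Proof. by rewrite /step_fun => ij; do 2!case: ifP => //; lia. Qed.

Definition step n k : delta n 1 := Delta (monotonebP (@step_mono n k)).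

Lemma stepE n k i : step n k i = if (k < i)%N then ord_max else ord0.
Proof. by rewrite ffunE. Qed.

(* The simplex of the circle jumping between the vertices k and k + 1; it is the
   base point as soon as n <= k. *)
Definition circ n k : simplicial_circle n :=
  insub (step n k : simplex 1 n) : collapse_cell (boundary 1) n.

Lemma circ_ge n k : (n <= k)%N -> circ n k = base simplicial_circle n.
Proof.
move=> nk; rewrite /circ insubF //; apply/negbTE; rewrite negbK.
apply/existsP; exists ord_max; apply/codomP => -[i].
by rewrite stepE ltnNge (leq_trans _ nk) // -ltnS.
Qed.

(** By monotonicity, a value that is taken at all is taken at an end: 0 at the first vertex, 1 at
    the last. *)
Lemma boundaryP n (x : delta n 1) :
  in_boundary (k := 1) x = ~~ ((x ord0 == ord0) && (x ord_max == ord_max)).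
Proof.
apply/existsP/idP => [[j /negP jx]|].
  apply/negP => /andP[/eqP x0 /eqP xm]; apply: jx; apply/codomP.
  case: (unliftP ord0 j) => [k ->|->]; last by exists ord0.
  by exists ord_max; rewrite xm; apply: val_inj; rewrite /= (ord1 k).
rewrite negb_and => /orP[x0|xm].
  exists ord0; apply/codomP => -[i i0]; move/eqP: x0; apply; apply: val_inj.
  apply/eqP; rewrite -leqn0 /= -[X in (_ <= X)%N]/(val (ord0 : 'I_2)) i0.
  exact: delta_homo.
exists ord_max; apply/codomP => -[i im]; move/eqP: xm; apply; apply: val_inj.
apply/eqP; rewrite eqn_leq -ltnS ltn_ord /=.
by rewrite -[X in (X <= _)%N]/(val (ord_max : 'I_2)) im delta_homo // -ltnS.
Qed.

(** Strips the option and subset types, so that nontrivial generators can be compared through their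
    step maps. *)
Lemma circ_val n k (kn : (k < n)%N) :
  omap (fun y : {y | ~~ boundary 1 n y} => val y)
    (circ n k : collapse_cell _ n) = Some (step n k).
Proof.
rewrite /circ; case: insubP => [y _ <- //|].
by rewrite negbK /= boundaryP !stepE /= kn.
Qed.

Lemma circ_inj n k l :
  (k < n)%N -> (l < n)%N -> circ n k = circ n l -> k = l.
Proof.
move=> kn ln kl.
have : Some (step n k) = Some (step n l) by rewrite -!circ_val // kl.
case=> /ffunP st; have := st (inord k.+1); have := st (inord l.+1).
rewrite !ffunE /step_fun !inordK ?ltnS //.
by case: ltngtP => //; do !case: ifP => //; lia.
Qed.

Lemma circ_surj n (x : simplicial_circle n) : exists k, x = circ n k.
Proof.
case: x => [[x xb]|]; last by exists n; rewrite circ_ge.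
have := xb; rewrite /= boundaryP negbK => /andP[/eqP x0 /eqP xm].
(* The jump occurs just after the last vertex that [x] sends to 0. *)
pose P k := (k <= n)%N && (x (inord k) == ord0).
have exP : exists k, P k.
  exists 0%N; apply/eqP; rewrite -x0; congr (x _).
  by apply: val_inj; rewrite /= inordK.
have Pn k : P k -> (k <= n)%N by case/andP.
case: (ex_maxnP exP Pn) => k /andP[kn /eqP xk] kmax; exists k.
have -> : circ n k = Some (exist _ x xb) :> collapse_cell _ n; last by [].
have stx : step n k = x.
  apply: deltaP => i; rewrite stepE; case: ltnP => ki.
    apply/eqP; apply: contraTT ki => xi; rewrite -leqNgt; apply: kmax.
    rewrite /P -ltnS ltn_ord inord_val /=.
    case: (unliftP ord_max (x i)) xi => [j ->|->]; rewrite ?eqxx //.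
    by rewrite (ord1 j) => _; apply/eqP/val_inj.
  apply: val_inj; apply/esym/eqP; rewrite -leqn0 /=.
  by rewrite -[X in (_ <= X)%N]/(val (ord0 : 'I_2)) -xk delta_homo // inordK.
by rewrite /circ insubT /= ?stx // => p; congr Some; apply: val_inj.
Qed.

(** The base point is not in the list, so its index is the length n. *)
Definition circ_letter n (x : simplicial_circle n) : nat :=
  index x [seq circ n k | k <- iota 0 n].

Lemma circ_letter_le n x : (@circ_letter n x <= n)%N.
Proof. by rewrite -{2}(size_iota 0 n) -(size_map (circ n)) index_size. Qed.

Lemma circ_letterK n : cancel (@circ_letter n) (circ n).
Proof.
move=> x; rewrite /circ_letter; set s := map _ _.
have [xs|xs] := boolP (x \in s).
  have := xs; rewrite -index_mem size_map size_iota => xn.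
  by rewrite -[RHS](nth_index x xs) (nth_map 0%N) ?size_iota // nth_iota.
have [k xk] := circ_surj x; rewrite memNindex // size_map size_iota.
rewrite circ_ge // xk circ_ge // leqNgt; apply: contra xs => kn.
by rewrite xk; apply: map_f; rewrite mem_iota.
Qed.

Lemma circ_letter_circ n k : circ_letter (circ n k) = minn k n.
Proof.
have [kn|nk] := ltnP k n.
  apply: circ_inj (circ_letterK _) => //.
  have := index_mem (circ n k) [seq circ n l | l <- iota 0 n].
  rewrite size_map size_iota /circ_letter => ->.
  by apply: map_f; rewrite mem_iota.
apply/eqP; rewrite eqn_leq circ_letter_le leqNgt.
by apply/negP => ln; have := circ_val ln; rewrite circ_letterK (circ_ge nk).
Qed.

Lemma circ_letter_base n : circ_letter (base simplicial_circle n) = n.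
Proof. by rewrite -(circ_ge (leqnn n)) circ_letter_circ minnn. Qed.

(* The i-th face sends the generator k to the generator [face_letter n i k],
   where the value n stands for the base point. *)
Definition face_letter n (i k : nat) : nat :=
  if (k < i)%N then k else if k is l.+1 then l else n.

Lemma act_circ m n (f : delta m n) k l :
  (forall i, (k < f i)%N = (l < i)%N) -> act f (circ n k) = circ m l.
Proof.
move=> fkl; have stf : simplex_act f (step n k) = step m l.
  by apply: deltaP => i; rewrite delta_compE !stepE fkl.
have [kn|nk] := ltnP k n; last first.
  rewrite (circ_ge nk) act_base circ_ge // leqNgt; apply/negP => lm.
  by have := fkl ord_max; rewrite /= lm ltnNge (leq_trans _ nk) // -ltnS ltn_ord.
have := circ_val kn; rewrite /circ; case: insubP => //= y _ yk _.
by rewrite yk stf.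
Qed.

Lemma act_circ_base m n (f : delta m n) k :
  (forall i, (k < f i)%N) -> act f (circ n k) = base _ m.
Proof.
move=> fk; have [kn|nk] := ltnP k n; last by rewrite circ_ge // act_base.
have := circ_val kn; rewrite /circ; case: insubP => //= y _ yk _.
rewrite yk insubF //; apply/negbTE; rewrite negbK boundaryP.
by rewrite !delta_compE !stepE !fk.
Qed.

Lemma coface_circ n (i : 'I_n.+2) k :
  act (coface i) (circ n.+1 k) = circ n (face_letter n i k).
Proof.
rewrite /face_letter; case: ltnP => ki; last case: k ki => [|k] ki.
- by apply: act_circ => j; rewrite cofaceE /= /bump; lia.
- rewrite [RHS]circ_ge //; apply: act_circ_base => j.
  by rewrite cofaceE /= /bump; lia.
- by apply: act_circ => j; rewrite cofaceE /= /bump; lia.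
Qed.

Lemma codegeneracy_circ n k :
  act (codegeneracy ord_max) (circ n k) =
  if (k < n)%N then circ n.+1 k else base _ n.+1.
Proof.
case: ltnP => kn; last by rewrite circ_ge // act_base.
apply: act_circ => j; rewrite codegeneracyE squashE /= /unbump.
by have := ltn_ord j; lia.
Qed.

(** * Cohen's groups *)

Section CohenGroups.
Variable S : pointed_sset.

Lemma gactR (G : sgroup) m n (f : delta m n) (x y : G n) :
  gact f [~ x, y]%g = [~ gact f x, gact f y]%g.
Proof. by rewrite !commgEl gactM gactV gactJ. Qed.

Lemma gact_milnor_gen m n (f : delta m n) (x : S n) :
  gact f (milnor_gen x) = milnor_gen (act f x).
Proof. by rewrite /= sgquot_act_class /= fg_map_gen. Qed.

Lemma gact_repeated_commutator m n (f : delta m n) (a : milnor S n) :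
  repeated_commutator a -> repeated_commutator (gact f a).
Proof.
case=> x [s [xs ->]]; exists (act f x), [seq act f y | y <- s]; split.
  by apply: contra xs; rewrite -map_cons => /map_uniq.
elim/last_ind: s {xs} => [|s y IHs]; first exact: gact_milnor_gen.
by rewrite map_rcons !foldl_rcons gactR IHs gact_milnor_gen.
Qed.

(** When the relators are stable under the simplicial operators, so is their normal closure in each
    dimension, and closing under operators adds nothing. *)
Lemma simplicial_closure_normal (G : sgroup) (R : forall n, G n -> Prop)
    (Ract : forall m n (f : delta m n) x, R n x -> R m (gact f x)) n (x : G n) :
  simplicial_closure R x -> normal_closure (R n) x.
Proof.
move=> Rx; rewrite -(gact_id x).
(* Strengthening the claim to all operators turns the case of [SClosureAct] into a composition. *)
have : forall m (f : delta m n), normal_closure (R m) (gact f x); last exact.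
elim: Rx => {n x} [n x Rx|n|n x y _ hx _ hy|n x _ hx|n x y _ hx|p n f x _ hx] m g.
- exact/NClosureGen/Ract.
- by rewrite gact1; apply: NClosure1.
- by rewrite gactM; apply: NClosureM.
- by rewrite gactV; apply: NClosureV.
- by rewrite gactJ; apply: NClosureJ.
- by rewrite -gact_comp; apply: hx.
Qed.

Definition cohen_gen n (x : S n) : cohen S n :=
  gclass (coset_congr (simplicial_closure_sub (@repeated_commutator S) n))
    (milnor_gen x).

Lemma gact_cohen_gen m n (f : delta m n) (x : S n) :
  gact f (cohen_gen x) = cohen_gen (act f x).
Proof.
rewrite [LHS]sgquot_act_class; congr gclass; exact: gact_milnor_gen.
Qed.

Lemma cohen_gen_base n : cohen_gen (base S n) = 1%g.
Proof.
rewrite -[RHS]gclass1; congr gclass; rewrite -[RHS]gclass1.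
by apply/esym/gclass_eq; rewrite /= /coset_rel invg1 mul1g; apply: NClosureGen.
Qed.

Lemma cohen_ind n (P : cohen S n -> Prop) :
  P 1%g -> (forall g h, P g -> P h -> P (g * h)%g) ->
  (forall g, P g -> P g^-1%g) -> (forall x, P (cohen_gen x)) -> forall g, P g.
Proof.
move=> P1 PM PV Pgen g; have [a ->] := gclassP g; have [b ->] := gclassP a.
(* Here [a] lives in Milnor's group and [b] in the free group; the induction is on a word for
   [b]. *)
have [u ->] := wclassP b; elim: u => [|[x e] u IHu]; first exact: P1.
rewrite -cat1s wclassM; set N' := coset_congr _; set N := coset_congr _.
have -> : gclass N' (gclass N (wclass [:: (x, e)] * wclass u)%g) =
    (gclass N' (gclass N (wclass [:: (x, e)])) *
     gclass N' (gclass N (wclass u)))%g.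
  by rewrite -gclassM; congr gclass; rewrite -gclassM.
apply: PM; last exact: IHu.
case: e; last exact: Pgen.
have -> : wclass [:: (x, true)] = (fg_gen x)^-1%g by rewrite [RHS]wclass_inv.
have -> : gclass N' (gclass N (fg_gen x)^-1%g) = (cohen_gen x)^-1%g.
  by rewrite /cohen_gen -gclassV; congr gclass; rewrite -gclassV.
exact/PV/Pgen.
Qed.

Lemma cohen_repeated n (x : S n) s : ~~ uniq (x :: s) ->
  foldl (fun u y => [~ u, cohen_gen y]%g) (cohen_gen x) s = 1%g.
Proof.
move=> xs; pose a := foldl (fun u y => [~ u, milnor_gen y]%g) (milnor_gen x) s.
have Ra : repeated_commutator a by exists x, s.
set N := coset_congr (simplicial_closure_sub (@repeated_commutator S) n).
have -> : foldl (fun u y => [~ u, cohen_gen y]%g) (cohen_gen x) s = gclass N a.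
  rewrite /a; elim/last_ind: s {xs a Ra} => [//|s y IHs].
  by rewrite !foldl_rcons IHs !commgEl !conjgE !gclassM !gclassV.
rewrite -[RHS]gclass1; apply/esym/gclass_eq.
by rewrite /= /coset_rel invg1 mul1g; apply: SClosureGen.
Qed.

End CohenGroups.

Definition kgen n k : cohen simplicial_circle n := cohen_gen (circ n k).

Lemma kgen_ge n k : (n <= k)%N -> kgen n k = 1%g.
Proof. by move=> nk; rewrite /kgen circ_ge // cohen_gen_base. Qed.

Lemma face_kgen n (i : 'I_n.+2) k :
  face i (kgen n.+1 k) = kgen n (face_letter n i k).
Proof. by rewrite /face gact_cohen_gen coface_circ. Qed.

Lemma degeneracy_kgen n k :
  degeneracy ord_max (kgen n k) = if (k < n)%N then kgen n.+1 k else 1%g.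
Proof.
rewrite /degeneracy gact_cohen_gen codegeneracy_circ.
by case: ifP; rewrite ?cohen_gen_base.
Qed.

Lemma kgen_ind n (P : cohen simplicial_circle n -> Prop) :
  P 1%g -> (forall g h, P g -> P h -> P (g * h)%g) ->
  (forall g, P g -> P g^-1%g) -> (forall k, P (kgen n k)) -> forall g, P g.
Proof.
move=> P1 PM PV Pgen; apply: cohen_ind => // x.
by rewrite -(circ_letterK x); apply: Pgen.
Qed.

Definition lcomm n k (s : seq nat) : cohen simplicial_circle n :=
  foldl (fun u j => [~ u, kgen n j]%g) (kgen n k) s.

Lemma lcomm_rcons n k s j : lcomm n k (rcons s j) = [~ lcomm n k s, kgen n j]%g.
Proof. exact: foldl_rcons. Qed.

Lemma lcomm_repeated n k s : ~~ uniq (k :: s) -> lcomm n k s = 1%g.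
Proof.
move=> ks; rewrite -(@cohen_repeated _ n (circ n k) [seq circ n j | j <- s]).
  have E r u : foldl (fun v j => [~ v, kgen n j]%g) u r =
      foldl (fun v y => [~ v, cohen_gen y]%g) u [seq circ n j | j <- r].
    by elim: r u => //= j r IHr u; rewrite IHr.
  exact: E.
by apply: contra ks; rewrite -map_cons => /map_uniq.
Qed.

(** Letters from n on stand for the base point, and a commutator with 1 is 1. *)
Lemma lcomm_ge n k s : ~~ all (gtn n) (k :: s) -> lcomm n k s = 1%g.
Proof.
elim/last_ind: s => [|s j IHs] /=.
  by rewrite andbT -leqNgt => nk; rewrite /lcomm /= kgen_ge.
rewrite all_rcons andbCA negb_and -leqNgt lcomm_rcons => /orP[nj|/IHs ->].
  by rewrite kgen_ge // commg1.
by rewrite comm1g.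
Qed.

Lemma face_lcomm n (i : 'I_n.+2) k s :
  face i (lcomm n.+1 k s) = lcomm n (face_letter n i k) (map (face_letter n i) s).
Proof.
elim/last_ind: s => [|s j IHs]; first exact: face_kgen.
by rewrite map_rcons !lcomm_rcons -face_kgen -IHs; apply: gactR.
Qed.

(** * The action of Cohen's group on words *)

Section CohenAction.
Variable m : nat.

Let n := m.+1.
Let N (x : simplicial_circle n) : wordfun -> wordfun := append m (circ_letter x).

Definition circle_free_act : raction (free_group (simplicial_circle n)) wordfun :=
  free_raction (fun x => @appendD m (circ_letter x))
    (fun x => @append_square m (circ_letter x)).

Lemma circle_free_act_gen c x : circle_free_act c (fg_gen x) = c + N x c.
Proof.
by apply: free_act_gen => [y|y d]; [apply: appendD | apply: append_square].
Qed.

Lemma base_acts_trivially g :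
  base_closure simplicial_circle n g -> acts_trivially circle_free_act g.
Proof.
apply: acts_trivially_closure => _ -> c.
by rewrite circle_free_act_gen /N circ_letter_base append_gt ?addr0.
Qed.

Definition circle_milnor_act : raction (milnor simplicial_circle n) wordfun :=
  quot_raction base_acts_trivially.

Lemma circle_milnor_act_gen c x :
  circle_milnor_act c (milnor_gen x) = c + N x c.
Proof. rewrite -circle_free_act_gen; exact: (quot_act_class base_acts_trivially). Qed.

Lemma supp_has_act y g c :
  supp_has y c -> supp_has y (circle_milnor_act c g).
Proof.
have [a ->] := gclassP g.
rewrite [circle_milnor_act _ _](quot_act_class base_acts_trivially).
apply: free_act_stable.
- by move=> x; apply: appendD.
- by move=> x d; apply: append_square.
- exact: supp_hasD.
- exact: supp_hasN.
- by move=> x d; apply: supp_has_append.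
Qed.

Lemma unipotent_gen x :
  unipotent circle_milnor_act (supp_has (circ_letter x)) (milnor_gen x).
Proof.
split=> c; rewrite circle_milnor_act_gen; last first.
  by move=> cx; rewrite /N append_has0 // addr0.
by rewrite addrAC subrr add0r; apply: append_supp_has.
Qed.

(** A commutator involving y is unipotent for the words containing y, as is the generator y itself.
    Hence their operators commute, and a commutator acts trivially from its first repeated letter
    on. *)
Lemma repeated_acts_trivially a :
  repeated_commutator a -> acts_trivially circle_milnor_act a.
Proof.
case=> x [s [xs ->]].
pose u s := foldl (fun u y => [~ u, milnor_gen y]%g) (milnor_gen x) s.
have u_rcons r y : u (rcons r y) = [~ u r, milnor_gen y]%g by exact: foldl_rcons.
have uni r y : y \in x :: r ->
    unipotent circle_milnor_act (supp_has (circ_letter y)) (u r).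
  have uR g h : unipotent circle_milnor_act (supp_has (circ_letter y)) g ->
      unipotent circle_milnor_act (supp_has (circ_letter y)) [~ g, h]%g.
    apply: unipotentR => *.
    - exact: supp_hasD.
    - exact: supp_hasN.
    - exact: supp_has_act.
  elim/last_ind: r => [|r z IHr].
    by rewrite inE => /eqP ->; apply: unipotent_gen.
  rewrite -rcons_cons mem_rcons inE u_rcons => /orP[/eqP yz|yr].
    (* The unipotent factor is the second one here, so the commutator is replaced by the inverse of
       the one with its entries exchanged. *)
    rewrite -yz -invgR; apply: unipotentV => [*|]; first exact: supp_hasN.
    exact/uR/unipotent_gen.
  by apply: uR; apply: IHr.
rewrite -/(u s).
elim/last_ind: s xs => [//|s y IHs].
(* Either the last letter has occurred before, or the repetition lies in the shorter commutator,
   which then acts trivially by induction. *)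
rewrite -rcons_cons rcons_uniq negb_and negbK u_rcons => /orP[yxs|/IHs u1].
  apply: (unipotent_comm (J := supp_has (circ_letter y))); first exact: uni.
  exact: unipotent_gen.
rewrite commgEl; apply: acts_triviallyM; first exact: acts_triviallyV.
exact: acts_triviallyJ.
Qed.

Lemma closure_acts_trivially g :
  simplicial_closure_sub (@repeated_commutator simplicial_circle) n g ->
  acts_trivially circle_milnor_act g.
Proof.
move=> /(simplicial_closure_normal (@gact_repeated_commutator _)).
by apply: acts_trivially_closure; apply: repeated_acts_trivially.
Qed.

Definition cohen_act : raction (cohen simplicial_circle n) wordfun :=
  quot_raction closure_acts_trivially.

Lemma cohen_act_gen c k : cohen_act c (kgen n k) = c + append m k c.
Proof.
rewrite [LHS](quot_act_class closure_acts_trivially).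
rewrite circle_milnor_act_gen /N circ_letter_circ.
(* For n <= k both letters, k and n, exceed m, so both sides reduce to [c]. *)
by have [//|nk] := ltnP k n; rewrite !append_gt.
Qed.

Lemma cohen_act_supp_has y g c : supp_has y c -> supp_has y (cohen_act c g).
Proof.
have [a ->] := gclassP g.
rewrite [cohen_act _ _](quot_act_class closure_acts_trivially).
exact: supp_has_act.
Qed.

End CohenAction.

(** * Commutators starting with the last generator *)

Definition good (m : nat) : pred (seq nat) := fun w => uniq w && all (gtn m) w.

(** Separates the two reasons why the commutator of a bad word is trivial: a repetition in m :: w,
    or a letter standing for the base point. *)
Lemma goodE m w : good m w = uniq (m :: w) && all (gtn m.+1) w.
Proof.
rewrite /good /= -andbA andbCA; congr andb; elim: w => //= j w ->.
by rewrite inE negb_or; case: (m \in w) => /=; rewrite ?andbF //; lia.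
Qed.

Lemma good_rcons m w j :
  good m (rcons w j) = [&& good m w, (j < m)%N & j \notin w].
Proof.
rewrite /good rcons_uniq all_rcons /=.
by case: (j \in w); case: (uniq w); case: (j < m)%N; rewrite ?andbF ?andbT.
Qed.

(** Here [words k] lists the words of length k; distinct letters below m form words of length at
    most m, so the list is complete. *)
Definition goodwords m : seq (seq nat) :=
  let words k := iter k (fun s => [seq j :: w | j <- iota 0 m, w <- s]) [:: [::]] in
  undup [seq w <- flatten [seq words k | k <- iota 0 m.+1] | good m w].

Lemma goodwords_uniq m : uniq (goodwords m).
Proof. exact: undup_uniq. Qed.

Lemma mem_goodwords m w : (w \in goodwords m) = good m w.
Proof.
rewrite mem_undup mem_filter andb_idr // => /andP[w_uniq wm].
apply/flatten_mapP; exists (size w).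
  rewrite mem_iota ltnS -(size_iota 0 m) uniq_leq_size // => j /(allP wm) jm.
  by rewrite mem_iota.
elim: w wm {w_uniq} => [//|j w IHw] /= /andP[jm /IHw wm].
by apply: allpairs_f; rewrite // mem_iota.
Qed.

Section WordCoefficients.
Variable m : nat.

(** The letter m is present from the start, so a letter can be appended exactly when it is new and
    below m. *)
Lemma foldl_append w :
  foldl (fun c j => append m j c) (append m m (word_ind [::])) w =
  if good m w then word_ind (rev (m :: w)) else 0.
Proof.
elim/last_ind: w => [|w j IHw]; first by rewrite append_word leqnn /= eqxx.
rewrite foldl_rcons IHw good_rcons; have [/= gw|_] := boolP (good m w).
  rewrite append_word rev_cons mem_rcons inE mem_rev negb_or.
  rewrite -[_ == [::]]size_eq0 size_rcons /= andbT andbA.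
  rewrite (andbC (j <= m)%N) -ltn_neqAle.
  by rewrite rev_cons rev_rcons.
exact: append0.
Qed.

(** The reversal is due to words being stored from right to left. *)
Definition coef (w : seq nat) (c : wordfun) : int := c (rev (m :: w)).

Lemma coefD w : {morph coef w : c d / c + d}.
Proof. by []. Qed.

Lemma coef_foldl_append v w : good m v ->
  coef v (foldl (fun c j => append m j c) (append m m (word_ind [::])) w) =
  (v == w)%:R.
Proof.
move=> gv; rewrite foldl_append; case: ifP => gw.
  by rewrite /coef /word_ind (inj_eq (inv_inj revK)) eqseq_cons eqxx.
by case: eqP gw => // <-; rewrite gv.
Qed.

End WordCoefficients.

Section TopCommutators.
Variable m : nat.
Notation K := (cohen simplicial_circle m.+1).
Notation x := (kgen m.+1).
Notation c := (lcomm m.+1 m).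
Notation e := (word_ind [::]).

(** The subgroup H generated by the commutators starting with x_m. Its normality is [topJ], and
    [top_kernel] shows that it contains the kernel of the last face. *)
Inductive in_top : K -> Prop :=
| TopGen w : in_top (c w)
| Top1 : in_top 1%g
| TopM g h of in_top g & in_top h : in_top (g * h)%g
| TopV g of in_top g : in_top g^-1%g.

Lemma top_commute_gen h : in_top h -> commute (x m) h.
Proof.
elim=> [w||g h' _ hg _ hh|g _ hg].
- apply/commute_sym/commgP; rewrite -lcomm_rcons lcomm_repeated //=.
  by rewrite mem_rcons inE eqxx.
- exact: commute1.
- exact: commuteM.
- exact: commuteV.
Qed.

(** Conjugating [c w] by x_j multiplies it by [c (rcons w j)], and x_j fixes the latter because one
    more j would be a repetition. *)
Lemma topJ h g : in_top h -> in_top (h ^ g)%g.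
Proof.
(* Treating [g] and its inverse together makes the induction pass through inverses. *)
move=> hT; suff [] : in_top (h ^ g)%g /\ in_top (h ^ g^-1)%g by [].
elim/kgen_ind: g h hT => [|g g' hg hg'|g hg|j] h hT.
- by rewrite invg1 conjg1.
- rewrite invgM !conjgM; split; first by apply: (hg' _ (hg _ hT).1).1.
  exact: (hg _ (hg' _ hT).2).2.
- by rewrite invgK; have [] := hg _ hT.
elim: hT => [w||g g' _ [g1 g2] _ [h1 h2]|g _ [g1 g2]].
- have cJ : (c w ^ x j = c w * c (rcons w j))%g.
    by rewrite lcomm_rcons commgEl mulVKg.
  have cjJ : (c (rcons w j) ^ x j = c (rcons w j))%g.
    apply/conjg_fixP; rewrite -lcomm_rcons lcomm_repeated //.
    by rewrite -!rcons_cons rcons_uniq mem_rcons inE eqxx.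
  rewrite cJ; split; first exact/TopM/TopGen/TopGen.
  have -> : (c w ^ (x j)^-1 = c w * (c (rcons w j))^-1)%g.
    by rewrite -[RHS](conjgK (x j)) conjMg conjVg cJ cjJ mulgK.
  exact/TopM/TopV/TopGen/TopGen.
- by rewrite !conj1g; split; apply: Top1.
- by rewrite !conjMg; split; apply: TopM.
- by rewrite !conjVg; split; apply: TopV.
Qed.

(** Induction on the word, from [c (rcons w j)] = ([c w])^-1 ([c w])^x_j: the second factor commutes
    with [h] because [c w] commutes with the conjugate of [h] by the inverse of x_j, again in H. *)
Lemma top_commute g h : in_top g -> in_top h -> commute g h.
Proof.
move=> gT hT; elim: gT => [w||g1 g2 _ hg1 _ hg2|g' _ hg'].
- elim/last_ind: w h hT => [|w j IHw] h hT; first exact: top_commute_gen.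
  rewrite lcomm_rcons commgEl; apply/commute_sym/commuteM; apply/commute_sym.
    exact/commute_sym/commuteV/commute_sym/IHw.
  have /(congr1 (conjg^~ (x j))) := IHw _ (topJ (x j)^-1%g hT).
  by rewrite (conjMg (c w)) (conjMg _ (c w)) conjgKV.
- exact/commute_sym/commute1.
- exact/commute_sym/commuteM/commute_sym.
- exact/commute_sym/commuteV/commute_sym.
Qed.

(** The last face followed by the last degeneracy fixes x_k for k < m and kills x_m. So [g] times
    the inverse of its image is in H for each generator, hence, H being normal, for every [g]; on
    the kernel this product is [g]. *)
Lemma top_kernel g : face ord_max g = 1%g -> in_top g.
Proof.
move=> g1; pose sd h : K := degeneracy ord_max (face ord_max h).
have sdM h k : sd (h * k)%g = (sd h * sd k)%g by rewrite /sd faceM degeneracyM.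
have sdV h : sd h^-1%g = (sd h)^-1%g by rewrite /sd faceV; apply: gactV.
have : in_top (g * (sd g)^-1)%g; last by rewrite /sd g1 degeneracy1 invg1 mulg1.
elim/kgen_ind: g {g1} => [|g h hg hh|g hg|k].
- by rewrite /sd face1 degeneracy1 mulgV; apply: Top1.
- have -> : ((g * h) * (sd (g * h))^-1 =
      (h * (sd h)^-1) ^ g^-1 * (g * (sd g)^-1))%g.
    by rewrite sdM invgM conjgE invgK !mulgA mulgVK.
  exact/TopM/hg/topJ.
- have -> : (g^-1 * (sd g^-1)^-1 = ((g * (sd g)^-1) ^ g)^-1)%g.
    by rewrite sdV conjgE !invgM !invgK !mulgA mulgVK.
  exact/TopV/topJ.
rewrite /sd face_kgen degeneracy_kgen /face_letter /= ltnS.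
have [km|mk|->] := ltngtP k m.
- by rewrite /= km mulgV; apply: Top1.
- case: k mk => // k mk; rewrite kgen_ge // mul1g /=.
  by case: ifP => [|_]; [lia | rewrite invg1; apply: Top1].
- by rewrite /= ltnn invg1 mulg1; apply: (TopGen [::]).
Qed.

Notation A := (cohen_act m).

Lemma unipotent_kgen j : unipotent A (supp_has j) (x j).
Proof.
split=> d; rewrite cohen_act_gen; last by move=> dj; rewrite append_has0 // addr0.
by rewrite addrAC subrr add0r; apply: append_supp_has.
Qed.

(** True of x_m, and inherited by commutators, products and inverses. This is what makes
    coefficients additive on H. *)
Lemma unipotent_top g : in_top g -> unipotent A (supp_has m) g.
Proof.
have JD := @supp_hasD m; have JN := @supp_hasN m.
elim=> [w||g1 g2 _ hg1 _ hg2|g' _ hg'].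
- elim/last_ind: w => [|w j IHw]; first exact: unipotent_kgen.
  rewrite lcomm_rcons; apply: unipotentR IHw => // *; exact: cohen_act_supp_has.
- by split=> d; rewrite ract_mul1 // subrr.
- exact: unipotentM.
- exact: unipotentV.
Qed.

(* Modulo the words not starting with m, the commutator [[x_m, x_w1], ...] acts
   on the empty word as 1 + x_m x_w1 .... *)
Lemma act_lcomm w :
  A e (c w) = e + foldl (fun d j => append m j d) (append m m e) w.
Proof.
elim/last_ind: w => [|w j IHw]; first exact: cohen_act_gen.
rewrite foldl_rcons lcomm_rcons; set p := foldl _ _ _ in IHw *.
have [uc1 uc2] := unipotent_top (TopGen w).
have pm : supp_has m p by rewrite -[p](addKr e) -IHw addrC; apply: uc1.
have [->|jm] := eqVneq j m.
  rewrite append_has0 // addr0 -lcomm_rcons lcomm_repeated ?ract_mul1 //=.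
  by rewrite mem_rcons inE eqxx.
have ej : A e (x j) = e.
  by rewrite cohen_act_gen append_word /= (negPf jm) andbF addr0.
have epV : A e (c w)^-1%g = e - p.
  have ep : A (e - p) (c w) = e by rewrite ractD ractN IHw uc2 // addrK.
  by rewrite -{1}ep ractK.
have ejV : A e (x j)^-1%g = e by rewrite -{1}ej ractK.
(* With p' the image of p under the inverse of x_j, the four factors send [e] in turn to e - p, e -
   p', e + p - p', and finally to e + (p + [append m j p]) - p. *)
rewrite commgEl conjgE !ractM epV ractD ejV ractD IHw uc2; last first.
  exact/cohen_act_supp_has/supp_hasN.
rewrite !ractD ej ractVK cohen_act_gen.
by rewrite -addrA [p + _ - p]addrAC subrr add0r.
Qed.

Definition top_coef w (g : K) : int := coef m w (A e g).

Lemma top_coefE w g : top_coef w g = coef m w (A e g - e).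
Proof.
(* The word read by [coef] contains m, so the empty word does not contribute. *)
have e0 : coef m w (- e) = 0.
  by rewrite /coef /word_ind opprfctE rev_cons; case: (rev w).
by rewrite coefD e0 addr0.
Qed.

Lemma top_coefM w g h :
  in_top g -> in_top h -> top_coef w (g * h)%g = top_coef w g + top_coef w h.
Proof.
move=> gT hT; rewrite !top_coefE.
rewrite (unipotentMD e (unipotent_top gT) (unipotent_top hT)); exact: coefD.
Qed.

Lemma top_coef1 w : top_coef w 1%g = 0.
Proof. by rewrite top_coefE ract_mul1 subrr. Qed.

Lemma top_coef_lcomm v w : good m v -> top_coef v (c w) = (v == w)%:R.
Proof. by move=> gv; rewrite top_coefE act_lcomm addrC addKr coef_foldl_append. Qed.

Lemma lcomm_bad w : ~~ good m w -> c w = 1%g.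
Proof.
rewrite goodE negb_and => /orP[|bw]; first exact: lcomm_repeated.
by apply: lcomm_ge; rewrite /= negb_and bw orbT.
Qed.

(** H written additively, so that integral combinations and dual functionals apply to it. *)
Record top := Top { top_val :> K; topP : `[< in_top top_val >] }.

HB.instance Definition _ := [isSub for top_val].
HB.instance Definition _ := [Choice of top by <:].

Lemma top_in (h : top) : in_top h.
Proof. exact/asboolP/topP. Qed.

Definition top_zero : top := Top (asboolT Top1).
Definition top_add (g h : top) : top := Top (asboolT (TopM (top_in g) (top_in h))).
Definition top_opp (g : top) : top := Top (asboolT (TopV (top_in g))).

Lemma top_addA : associative top_add.
Proof. by move=> g h k; apply: val_inj; apply: mulgA. Qed.

Lemma top_addC : commutative top_add.
Proof. by move=> g h; apply: val_inj; apply: top_commute; apply: top_in. Qed.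

Lemma top_add0 : left_id top_zero top_add.
Proof. by move=> g; apply: val_inj; apply: mul1g. Qed.

Lemma top_addN : left_inverse top_zero top_opp top_add.
Proof. by move=> g; apply: val_inj; apply: mulVg. Qed.

HB.instance Definition _ := GRing.isZmodule.Build top
  top_addA top_addC top_add0 top_addN.

Definition top_gen w : top := Top (asboolT (TopGen w)).

Lemma top_coefD w : {morph (fun h : top => top_coef w h) : g h / g + h}.
Proof. by move=> g h; apply: top_coefM; apply: top_in. Qed.

Lemma top_coef_intcomb w a : good m w ->
  top_coef w (intcomb (goodwords m) top_gen a : top) = a w.
Proof.
move=> gw; apply: (dual_intcomb (goodwords_uniq m) _ (top_coefD w)).
  by rewrite mem_goodwords.
by move=> v _; apply: top_coef_lcomm.
Qed.

Lemma top_span (h : top) : intspan (goodwords m) top_gen h.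
Proof.
(* Induction on the proof of membership needs a free variable in place of the projection of [h]. *)
have : exists2 g, in_top g & top_val h = g.
  by exists (top_val h); first exact: top_in.
case=> g gT; elim: gT h => {g} [w||g k gin hg kin hk|g gin hg] h hE.
- have [gw|bw] := boolP (good m w).
    have -> : h = top_gen w by apply: val_inj.
    by apply: intspan_gen; rewrite ?goodwords_uniq ?mem_goodwords.
  have -> : h = 0 by apply: val_inj; rewrite /= hE lcomm_bad.
  exact: intspan0.
- have -> : h = 0 by apply: val_inj.
  exact: intspan0.
- have -> : h = Top (asboolT gin) + Top (asboolT kin) by apply: val_inj.
  by apply: intspanD; [apply: hg | apply: hk].
have -> : h = - Top (asboolT gin) by apply: val_inj.
exact/intspanN/hg.
Qed.

Lemma top_expand (h : top) :
  h = intcomb (goodwords m) top_gen (fun w => top_coef w h).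
Proof.
have [a ha] := top_span h; rewrite {1}ha; apply: eq_big_seq => w.
by rewrite mem_goodwords => gw; rewrite ha top_coef_intcomb.
Qed.

End TopCommutators.

(** * Faces *)

(** These words are the permutations of 0, ..., m - 1. *)
Definition full (m : nat) : pred (seq nat) := fun w =>
  good m w && all (mem w) (iota 0 m).

Definition fullwords m := [seq w <- goodwords m | full m w].

Lemma full_good m w : full m w -> good m w.
Proof. by case/andP. Qed.

Lemma fullwords_uniq m : uniq (fullwords m).
Proof. exact/filter_uniq/goodwords_uniq. Qed.

Lemma mem_fullwords m w : (w \in fullwords m) = full m w.
Proof.
by rewrite mem_filter mem_goodwords andb_idr //; apply: full_good.
Qed.

Lemma full_mem m w j : full m w -> (j < m)%N -> j \in w.
Proof. by case/andP => _ /allP wm jm; apply: wm; rewrite mem_iota. Qed.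

Lemma full_size m w : full m w -> size w = m.
Proof.
case/andP => /andP[w_uniq /allP wm] /allP mw; rewrite -[RHS](size_iota 0).
apply/perm_size/uniq_perm; rewrite ?iota_uniq // => j.
by apply/idP/idP => [/wm|/mw //]; rewrite mem_iota.
Qed.

Lemma not_full m w : good m w -> ~~ full m w -> exists2 k, (k < m)%N & k \notin w.
Proof.
rewrite /full => -> /= /allPn[k]; rewrite mem_iota => km kw.
by exists k.
Qed.

Lemma uniq_map_inj_in (T T' : eqType) (f : T -> T') s :
  uniq (map f s) -> {in s &, injective f}.
Proof.
elim: s => //= x s IHs /andP[fx fs] y z; rewrite !inE.
move=> /orP[/eqP->|ys] /orP[/eqP->|zs] //.
- by move=> xz; rewrite xz map_f in fx.
- by move=> yx; rewrite -yx map_f in fx.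
exact: IHs.
Qed.

Lemma map_inj_in_eq (T T' : eqType) (P : pred T) (f : T -> T') s t :
  {in P &, injective f} -> all P s -> all P t -> map f s = map f t -> s = t.
Proof.
move=> f_inj; elim: s t => [|x s IHs] [|y t] //= /andP[Px Ps] /andP[Py Pt] [fxy st].
by rewrite (f_inj x y) // (IHs t).
Qed.

Lemma face_letter_inj n k :
  {in [pred j | (j < n) && (j != k)]%N &, injective (face_letter n k)}.
Proof.
move=> j l; rewrite !inE /face_letter => /andP[jn jk] /andP[ln lk].
by case: ifP; case: ifP; case: j jn jk => [|j]; case: l ln lk => [|l]; lia.
Qed.

(** Such a face lowers the letter m + 1 to m, so commutators still start with the last generator. *)
Lemma face_top_gen m (i : 'I_m.+3) w : (i <= m)%N ->
  face i (lcomm m.+2 m.+1 w) = lcomm m.+1 m (map (face_letter m.+1 i) w).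
Proof.
by move=> im; rewrite face_lcomm /face_letter ltnNge (leq_trans im).
Qed.

Lemma face_top m (i : 'I_m.+3) g : (i <= m)%N -> in_top g ->
  in_top (m := m) (face i g).
Proof.
move=> im; elim=> {g} [w||g h _ hg _ hh|g _ hg].
- by rewrite face_top_gen //; apply: TopGen.
- by rewrite face1; apply: Top1.
- by rewrite faceM; apply: TopM.
- by rewrite faceV; apply: TopV.
Qed.

(** A face relabels the letters of each commutator, so its matrix in these coordinates has entries 0
    and 1. *)
Lemma face_coef m (i : 'I_m.+3) (h : top m.+1) v : (i <= m)%N -> good m v ->
  top_coef v (face i h) =
  \sum_(w <- goodwords m.+1) (v == map (face_letter m.+1 i) w)%:R *~ top_coef w h.
Proof.
move=> im gv; rewrite [in LHS](top_expand h).
rewrite (additive_intcomb _ _ (phi := fun g : top m.+1 => top_coef v (face i g))).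
  by apply: eq_bigr => w _; rewrite face_top_gen // top_coef_lcomm.
move=> g k; rewrite -top_coefM -?faceM //; apply: face_top => //; exact: top_in.
Qed.

Lemma good_missing n k w : good n w -> k \notin w ->
  all [pred j | (j < n) && (j != k)]%N w.
Proof.
move=> /andP[_ /allP wn] kw; apply/allP => j jw; rewrite /= (wn j jw : _ < _)%N.
by apply: contraNneq kw => <-.
Qed.

Lemma map_face_letter_good m k w : (k <= m)%N ->
  good m.+1 w -> k \notin w -> good m (map (face_letter m.+1 k) w).
Proof.
move=> km gw kw; have /allP wk := good_missing gw kw.
have [w_uniq _] := andP gw; rewrite /good map_inj_in_uniq ?w_uniq /=; last first.
  by move=> j l /wk jk /wk lk; apply: (@face_letter_inj m.+1 k).
apply/allP => _ /mapP[j /wk /andP[jm jk] ->]; rewrite /= /face_letter.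
by case: ifP; case: j jm jk => [|j]; lia.
Qed.

(* The face d_k identifies the letters k - 1 and k, or kills the letter 0 if
   k = 0; so it is injective on words missing k, and the only other words with
   the same image miss k - 1. *)
Lemma coef_missing_step m (h : top m.+1) (i : 'I_m.+3) w : (i <= m)%N ->
  face i h = 1%g ->
  (forall v, (0 < i)%N -> good m.+1 v -> i.-1 \notin v -> top_coef v h = 0) ->
  good m.+1 w -> (i : nat) \notin w -> top_coef w h = 0.
Proof.
set k : nat := i => km h1 IHk gw kw; have gv := map_face_letter_good km gw kw.
have := face_coef h km gv; rewrite h1 top_coef1 => /esym.
rewrite (bigD1_seq w) ?goodwords_uniq ?mem_goodwords //= eqxx.
rewrite big1_seq ?addr0 => [|v /andP[vw]]; first by rewrite intz.
rewrite mem_goodwords => gv'; have [wv|_] := eqVneq; last by rewrite mul0rz.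
(* If [v] misses k too, injectivity gives v = w, which is excluded. *)
have [kv|kv] := boolP (k \in v); last first.
  case/eqP: vw; apply: (map_inj_in_eq (@face_letter_inj m.+1 k)) (esym wv).
    exact: good_missing.
  exact: good_missing.
(* For k = 0, the letter 0 of [v] would be sent to m + 1, which no good word contains. *)
have [k0|k_gt0] := posnP k.
  move: gv; rewrite wv => /andP[_ /allP/(_ (face_letter m.+1 k k))].
  by rewrite map_f // k0 /face_letter /= => /(_ isT); lia.
(* If [v] contained both k - 1 and k, its image would repeat a letter, but this image is a good
   word. *)
rewrite IHk ?mulr0z //; apply/negP => k1v.
have v_inj : {in v &, injective (face_letter m.+1 k)}.
  by apply: uniq_map_inj_in; rewrite -wv; case/andP: gv.
have : k.-1 = k; last lia.
apply: v_inj => //; rewrite /face_letter ltnn.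
by case: (k) k_gt0 => // j _; rewrite ltnSn.
Qed.

(** Induction on k: d_0 settles the words missing 0, and d_k passes from the words missing k - 1 to
    those missing k. *)
Lemma coef_missing m (h : top m) :
  (forall i : 'I_m.+2, (i < m)%N -> face i h = 1%g) ->
  forall k w, (k < m)%N -> good m w -> k \notin w -> top_coef w h = 0.
Proof.
case: m h => // m h h1; elim=> [|k IHk] w km gw kw.
  by apply: (@coef_missing_step m h ord0) => //; apply: h1.
have ik : (inord k.+1 : 'I_m.+3) = k.+1 :> nat by rewrite inordK //; lia.
apply: (@coef_missing_step m h (inord k.+1)); rewrite ?ik //.
  by apply: h1; rewrite ik.
by move=> v _ gv kv; apply: IHk => //; apply: ltnW.
Qed.

(** The last face kills x_m and d_0 kills the letter 0. Any other face identifies two consecutive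
    letters, both of which occur, and the repetition makes the commutator trivial. *)
Lemma face_full m (i : 'I_m.+2) w : full m w -> face i (lcomm m.+1 m w) = 1%g.
Proof.
move=> fw; have mw j : (j <= m)%N -> j \in m :: w.
  by rewrite leq_eqVlt inE => /orP[->//|/(full_mem fw) ->]; rewrite orbT.
rewrite face_lcomm; have := ltn_ord i; rewrite ltnS leq_eqVlt => /orP[/eqP ->|].
  by apply: lcomm_ge; rewrite /face_letter ltnSn /= ltnn.
case: (i : nat) => [|k] km.
  apply: lcomm_ge; rewrite -map_cons; apply/allPn; exists m; last by rewrite /= ltnn.
  by apply/mapP; exists 0%N; [apply: mw | ].
apply: lcomm_repeated; rewrite -map_cons; apply/negP => /uniq_map_inj_in.
move=> /(_ k k.+1 (mw _ _) (mw _ _)); rewrite /face_letter ltnSn ltnn.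
by move=> /(_ (ltnW km) km erefl); lia.
Qed.

Lemma top_expand_full m (h : top m) :
  (forall i : 'I_m.+2, (i < m)%N -> face i h = 1%g) ->
  h = intcomb (fullwords m) (top_gen m) (fun w => top_coef w h).
Proof.
move=> h1; rewrite {1}(top_expand h) /intcomb big_filter [LHS](bigID (full m)) /=.
rewrite [X in _ + X]big1_seq ?addr0 // => w /andP[nw].
rewrite mem_goodwords => gw; have [k km kw] := not_full gw nw.
by rewrite (coef_missing h1 km) // mulr0z.
Qed.

Lemma face_intcomb_full m a (i : 'I_m.+2) :
  face i (intcomb (fullwords m) (top_gen m) a : top m) = 1%g.
Proof.
apply: (intcomb_ind (P := fun k : top m => face i k = 1%g)) => [|x y x1 y1|x x1|w].
- exact: face1.
- by rewrite faceM x1 y1 mulg1.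
- by rewrite faceV x1 invg1.
- by rewrite mem_fullwords; apply: face_full.
Qed.

Lemma face_top_trivial m (h : top m) :
  (forall i : 'I_m.+2, (i < m)%N -> face i h = 1%g) ->
  forall i : 'I_m.+2, face i h = 1%g.
Proof. by move=> h1 i; rewrite (top_expand_full h1) face_intcomb_full. Qed.

(** Dividing the homotopy by the last degeneracy of [y] gives an element of H whose faces are
    trivial except perhaps one, x y^-1; by [face_top_trivial] that one is trivial too. *)
Lemma homotopic_eq m (x y : sphere (cohen simplicial_circle) m.+1) :
  sphere_homotopic x y -> x = y.
Proof.
case=> w [w1 wx wy]; apply: val_inj.
have ys := sphere_spherical y.
pose u := (w * (degeneracy ord_max (sphere_val y))^-1)%g.
have uT : in_top (m := m.+1) u.
  apply: top_kernel; rewrite faceM faceV wy face_degeneracy_spherical //=.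
  by rewrite leqnSn leqnn mulgV.
have u1 (i : 'I_m.+3) : (i < m.+1)%N -> face i u = 1%g.
  move=> im; rewrite faceM faceV w1 // face_degeneracy_spherical //=.
  by rewrite leqNgt im invg1 mulg1.
have : face (inord m.+1) u = 1%g.
  exact: (@face_top_trivial m.+1 (Top (asboolT uT)) u1).
rewrite faceM faceV wx face_degeneracy_spherical //= inordK ?leqnn ?leqnSn //.
exact: divg1_eq.
Qed.

Lemma sphere_top m (x : sphere (cohen simplicial_circle) m.+1) :
  in_top (m := m) (sphere_val x).
Proof. exact/top_kernel/(sphere_spherical x). Qed.

(** * The Lie algebra *)

Section LieAction.
Variable m : nat.
Notation L := (Lie_algebra m.+1).
Notation e := (word_ind [::]).

(** Operators compose from left to right, as for a right action; hence the order of the two terms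
    for [LBr]. *)
Fixpoint lterm_act (t : lterm 'I_m.+1) (c : wordfun) : wordfun :=
  match t with
  | LVar i => append m i c
  | LZero => 0
  | LAdd a b => lterm_act a c + lterm_act b c
  | LOpp a => - lterm_act a c
  | LBr a b => lterm_act b (lterm_act a c) - lterm_act a (lterm_act b c)
  end.

Lemma lterm_actD t : {morph lterm_act t : c d / c + d}.
Proof.
elim: t => [i||a IHa b IHb|a IHa|a IHa b IHb] c d /=.
- exact: appendD.
- by rewrite addr0.
- by rewrite IHa IHb addrACA.
- by rewrite IHa opprD.
- by rewrite IHa !IHb IHa opprD addrACA.
Qed.

Lemma lterm_actN t c : lterm_act t (- c) = - lterm_act t c.
Proof.
have t0 : lterm_act t 0 = 0.
  by apply: (addrI (lterm_act t 0)); rewrite -lterm_actD !addr0.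
by apply: (addrI (lterm_act t c)); rewrite -lterm_actD !subrr.
Qed.

Lemma lterm_act_eq a b c : lie_eq a b -> lterm_act a c = lterm_act b c.
Proof.
move=> ab; elim: ab c => {a b} /=.
- by [].
- by move=> a b _ ab c.
- by move=> a b d _ ab _ bd c; rewrite ab.
- by move=> a a' b b' _ aa' _ bb' c; rewrite aa' bb'.
- by move=> a a' _ aa' c; rewrite aa'.
- by move=> a a' b b' _ aa' _ bb' c; rewrite !(aa', bb').
- by move=> a b d c; rewrite addrA.
- by move=> a b c; rewrite addrC.
- by move=> a c; rewrite add0r.
- by move=> a c; rewrite addNr.
- by move=> a b d c; rewrite lterm_actD opprD addrACA.
- by move=> a b d c; rewrite lterm_actD opprD addrACA.
- by move=> a c; rewrite subrr.
move=> a b d c; rewrite !lterm_actD !lterm_actN !opprD !opprK.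
set A := lterm_act a; set B := lterm_act b; set D := lterm_act d.
(* At each word, the Jacobi identity is a linear identity between the values of the triple
   composites. *)
apply/funext => w; rewrite !(addrfctE, opprfctE) /=; lia.
Qed.

Definition free_lie_act (u : free_lie 'I_m.+1) (c : wordfun) : wordfun :=
  lterm_act (repr u) c.

Lemma free_lie_act_class a c : free_lie_act (lclass a) c = lterm_act a c.
Proof. exact/lterm_act_eq/repr_lclass. Qed.

Lemma free_lie_actD u : {morph free_lie_act u : c d / c + d}.
Proof. exact: lterm_actD. Qed.

Lemma free_lie_act0 u : free_lie_act u 0 = 0.
Proof. by apply: (addrI (free_lie_act u 0)); rewrite -free_lie_actD !addr0. Qed.

Lemma free_lie_act_add u v c :
  free_lie_act (u + v) c = free_lie_act u c + free_lie_act v c.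
Proof.
have [a ->] := lclassP u; have [b ->] := lclassP v.
by rewrite -lclassD !free_lie_act_class.
Qed.

Lemma free_lie_act_opp u c : free_lie_act (- u) c = - free_lie_act u c.
Proof. by have [a ->] := lclassP u; rewrite -lclassN !free_lie_act_class. Qed.

Lemma free_lie_act_br u v c : free_lie_act (lbr u v) c =
  free_lie_act v (free_lie_act u c) - free_lie_act u (free_lie_act v c).
Proof.
have [a ->] := lclassP u; have [b ->] := lclassP v.
by rewrite [lbr _ _]lclass_br !free_lie_act_class.
Qed.

Lemma free_lie_act_gen i c : free_lie_act (lie_gen i) c = append m i c.
Proof. exact: free_lie_act_class. Qed.

Lemma supp_has_free_lie_act y u c :
  supp_has y c -> supp_has y (free_lie_act u c).
Proof.
have [t ->] := lclassP u; rewrite free_lie_act_class.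
elim: t c => [i||a IHa b IHb|a IHa|a IHa b IHb] c cy //=.
- exact: supp_has_append.
- by apply: supp_hasD; [apply: IHa | apply: IHb].
- exact/supp_hasN/IHa.
- apply: supp_hasD; first exact/IHb/IHa.
  exact/supp_hasN/IHa/IHb.
Qed.

(** The Lie counterpart of [unipotent], without the summand 1. *)
Definition lie_nilpotent y (u : free_lie 'I_m.+1) :=
  (forall c, supp_has y (free_lie_act u c)) /\
  (forall c, supp_has y c -> free_lie_act u c = 0).

Lemma lie_nilpotent_gen (i : 'I_m.+1) : lie_nilpotent i (lie_gen i).
Proof.
split=> c; rewrite free_lie_act_gen; first exact: append_supp_has.
exact: append_has0.
Qed.

Lemma lie_nilpotent_brl y u v : lie_nilpotent y u -> lie_nilpotent y (lbr u v).
Proof.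
move=> [u1 u2]; split=> c => [|cy]; rewrite free_lie_act_br.
  by apply/supp_hasD/supp_hasN/u1/supp_has_free_lie_act.
by rewrite u2 // free_lie_act0 u2 ?subrr //; apply: supp_has_free_lie_act.
Qed.

Lemma lie_nilpotent_brr y u v : lie_nilpotent y u -> lie_nilpotent y (lbr v u).
Proof.
move=> [u1 u2]; split=> c => [|cy]; rewrite free_lie_act_br.
  by apply/supp_hasD/supp_hasN/supp_has_free_lie_act/u1/u1.
by rewrite (u2 c) // free_lie_act0 u2 ?subrr //; apply: supp_has_free_lie_act.
Qed.

Definition lie_word i (s : seq 'I_m.+1) : free_lie 'I_m.+1 :=
  foldl (fun v j => lbr v (lie_gen j)) (lie_gen i) s.

Lemma lie_word_nilpotent (i : 'I_m.+1) s (j : 'I_m.+1) :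
  j \in i :: s -> lie_nilpotent j (lie_word i s).
Proof.
elim/last_ind: s => [|s k IHs].
  by rewrite inE => /eqP ->; apply: lie_nilpotent_gen.
rewrite -rcons_cons mem_rcons inE /lie_word foldl_rcons => /orP[/eqP ->|/IHs js].
  exact/lie_nilpotent_brr/lie_nilpotent_gen.
exact: lie_nilpotent_brl.
Qed.

(** A bracket involving y and the generator y both map into the words containing y and vanish on
    them. Both composites are then 0, so the bracket of the two acts as 0, and so do all further
    brackets. *)
Lemma repeated_lie_act0 (u : free_lie 'I_m.+1) c :
  repeated_lie_element u -> free_lie_act u c = 0.
Proof.
case=> i [s [nis ->]]; rewrite -/(lie_word i s).
elim/last_ind: s nis c => [//|s k IHs].
rewrite -rcons_cons rcons_uniq negb_and negbK => nis c.
rewrite /lie_word foldl_rcons -/(lie_word i s) free_lie_act_br free_lie_act_gen.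
case/orP: nis => [kis|/IHs is0].
  have [s1 s2] := lie_word_nilpotent kis.
  rewrite free_lie_act_gen append_has0; last exact: s1.
  by rewrite sub0r s2 ?oppr0 //; apply: append_supp_has.
by rewrite free_lie_act_gen !is0 append0 subrr.

Qed.

Lemma ideal_act0 u c :
  generated_lie_ideal (@repeated_lie_element m.+1) u -> free_lie_act u c = 0.
Proof.
move=> uI; elim: uI c => {u} [u ur||u v _ hu _ hv|u _ hu|u v _ hu|u v _ hv] c.
- exact: repeated_lie_act0.
- by rewrite free_lie_act_class.
- by rewrite free_lie_act_add hu hv addr0.
- by rewrite free_lie_act_opp hu oppr0.
- by rewrite free_lie_act_br !hu free_lie_act0 subrr.
- by rewrite free_lie_act_br !hv free_lie_act0 subrr.
Qed.

Definition lie_act (u : L) (c : wordfun) : wordfun := free_lie_act (repr u) c.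

Lemma lie_act_class u c : lie_act (lie_class _ u) c = free_lie_act u c.
Proof.
apply/eqP; rewrite -subr_eq0 -free_lie_act_opp -free_lie_act_add.
by apply/eqP/ideal_act0/repr_lie_class.
Qed.

Lemma lie_act_add u v c : lie_act (u + v) c = lie_act u c + lie_act v c.
Proof.
have [a ->] := lie_classP u; have [b ->] := lie_classP v.
by rewrite -lie_classD !lie_act_class free_lie_act_add.
Qed.

Definition lie_bracket i (s : seq 'I_m.+1) : L :=
  foldl (fun v j => lbr v (Lie_gen j)) (Lie_gen i) s.

Lemma lie_bracket_rcons i s j :
  lie_bracket i (rcons s j) = lbr (lie_bracket i s) (Lie_gen j).
Proof. exact: foldl_rcons. Qed.

Lemma lie_bracketE i s : lie_bracket i s = lie_class _ (lie_word i s).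
Proof.
elim/last_ind: s => [//|s j IHs].
by rewrite lie_bracket_rcons IHs /lie_word foldl_rcons [LHS]lie_class_br.
Qed.

Lemma lie_bracket_repeated i s : ~~ uniq (i :: s) -> lie_bracket i s = 0.
Proof.
move=> nis; rewrite lie_bracketE -[RHS]lie_class0; apply/lie_class_eq.
by rewrite subr0; apply: IClosureGen; exists i, s.
Qed.

(** In [p, x_j] the term where p acts first is the expected one. In the other, x_j acts first on the
    empty word, which gives 0 unless j = m; then p, which involves x_m, kills the result. *)
Lemma lie_act_bracket s : lie_act (lie_bracket ord_max s) e =
  foldl (fun c j => append m j c) (append m m e) (map val s).
Proof.
rewrite lie_bracketE lie_act_class.
elim/last_ind: s => [|s j IHs]; first exact: free_lie_act_gen.
rewrite map_rcons foldl_rcons -IHs {1}/lie_word foldl_rcons -/(lie_word _ s).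
rewrite free_lie_act_br !free_lie_act_gen append_word.
case: ifP => [/andP[_ /eqP jm]|_]; last by rewrite free_lie_act0 subr0.
have [_ s2] := @lie_word_nilpotent ord_max s _ (mem_head _ _).
rewrite [X in _ - X]s2 ?subr0 // => w; rewrite /word_ind jm /= => mw.
by case: eqP mw => // ->; rewrite mem_head.
Qed.

Definition lie_coef w (u : L) : int := coef m w (lie_act u e).

Lemma lie_coefD w : {morph lie_coef w : u v / u + v}.
Proof. by move=> u v; rewrite /lie_coef lie_act_add. Qed.

(** The words are those of the group side, with natural numbers as letters; [inord] preserves the
    letters of good words. *)
Definition top_bracket (w : seq nat) : L := lie_bracket ord_max (map inord w).

Lemma lie_coef_top_bracket v w :
  good m v -> good m w -> lie_coef v (top_bracket w) = (v == w)%:R.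
Proof.
move=> gv /andP[_ /allP wm].
rewrite /lie_coef lie_act_bracket coef_foldl_append // -map_comp map_id_in // => j.
by move=> /wm jm; rewrite /= inordK // ltnW.
Qed.

Lemma lie_coef_intcomb w a :
  full m w -> lie_coef w (intcomb (fullwords m) top_bracket a) = a w.
Proof.
move=> fw; apply: (dual_intcomb (fullwords_uniq m) _ (lie_coefD w)).
  by rewrite mem_fullwords.
move=> v; rewrite mem_fullwords => fv.
by apply: lie_coef_top_bracket; apply: full_good.
Qed.

(** * Spanning by left-normed brackets *)

Lemma lbr_anti (K : lieRingType) (u v : K) : lbr u v = - lbr v u.
Proof.
apply/eqP; rewrite -addr_eq0; have := lbrxx (u + v).
by rewrite lbrDl !lbrDr !lbrxx add0r addr0 => ->.
Qed.

(** The Jacobi identity in the form that makes brackets left-normed. *)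
Lemma lbr_lbr (K : lieRingType) (u v w : K) :
  lbr u (lbr v w) = lbr (lbr u v) w - lbr (lbr u w) v.
Proof.
rewrite (lbr_anti u (lbr v w)) (lbr_anti u w) lbrNl opprK.
by apply/esym/eqP; rewrite -addr_eq0 addrAC lbr_jacobi.
Qed.

Inductive zspan (P : L -> Prop) : L -> Prop :=
| ZSpanGen u of P u : zspan P u
| ZSpan0 : zspan P 0
| ZSpanD u v of zspan P u & zspan P v : zspan P (u + v)
| ZSpanN u of zspan P u : zspan P (- u).

Lemma zspan_lift (P Q : L -> Prop) (f : L -> L) u :
  {morph f : u v / u + v} -> (forall v, P v -> zspan Q (f v)) ->
  zspan P u -> zspan Q (f u).
Proof.
move=> fD PQ; have f0 : f 0 = 0 by apply: (addrI (f 0)); rewrite -fD !addr0.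
elim=> {u} [u /PQ //||u v _ hu _ hv|u _ hu].
- by rewrite f0; apply: ZSpan0.
- by rewrite fD; apply: ZSpanD.
have -> : f (- u) = - f u by apply: (addrI (f u)); rewrite -fD !subrr.
exact: ZSpanN.
Qed.

Definition bracket_span k := zspan (fun u =>
  exists i s, (size s).+1 = k /\ u = lie_bracket i s).

Definition top_bracket_span k := zspan (fun u =>
  exists s, (size s).+1 = k /\ u = lie_bracket ord_max s).

Lemma bracket_span_gen k u j :
  bracket_span k u -> bracket_span k.+1 (lbr u (Lie_gen j)).
Proof.
apply: (zspan_lift (f := lbr^~ (Lie_gen j))) => [v w|v [i [s [<- ->]]]].
  exact: lbrDl.
by apply: ZSpanGen; exists i, (rcons s j); rewrite size_rcons lie_bracket_rcons.
Qed.

Lemma top_bracket_span_gen k u j :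
  top_bracket_span k u -> top_bracket_span k.+1 (lbr u (Lie_gen j)).
Proof.
apply: (zspan_lift (f := lbr^~ (Lie_gen j))) => [v w|v [s [<- ->]]].
  exact: lbrDl.
by apply: ZSpanGen; exists (rcons s j); rewrite size_rcons lie_bracket_rcons.
Qed.

(** By induction on [s], [lbr_lbr] moves the last generator outside; [u] has to vary, since one term
    has [u, x_j] in its place. [P] is abstract so as to cover all left-normed brackets as well as
    those starting with x_m. *)
Lemma zspan_bracket (P : nat -> L -> Prop) k u i s :
  (forall l v j, zspan (P l) v -> zspan (P l.+1) (lbr v (Lie_gen j))) ->
  zspan (P k) u -> zspan (P (k + (size s).+1)%N) (lbr u (lie_bracket i s)).
Proof.
move=> Pgen; elim/last_ind: s k u => [|s j IHs] k u Pu.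
  by rewrite addn1; apply: Pgen.
rewrite size_rcons addnS lie_bracket_rcons lbr_lbr.
apply: ZSpanD; first exact/Pgen/IHs.
by apply: ZSpanN; rewrite -addSn; apply/IHs/Pgen.
Qed.

Lemma monomial_bracket_span k u : lie_monomial k u -> bracket_span k u.
Proof.
elim=> {k u} [i|k l u v _ uk _ vl].
  by apply: ZSpanGen; exists i, [::].
apply: (zspan_lift (f := lbr u)) vl => [v' w|w [i [s [<- ->]]]]; first exact: lbrDr.
exact: zspan_bracket bracket_span_gen uk.
Qed.

(* A left-normed bracket ending in x_m is [v, x_m] = - [x_m, v]. *)
Lemma bracket_top_span i s :
  ord_max \in i :: s -> top_bracket_span (size s).+1 (lie_bracket i s).
Proof.
elim/last_ind: s => [|s j IHs].
  by rewrite inE => /eqP <-; apply: ZSpanGen; exists [::].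
rewrite -rcons_cons mem_rcons inE size_rcons lie_bracket_rcons => /orP[/eqP <-|/IHs].
  rewrite lbr_anti; apply: ZSpanN.
  apply: (@zspan_bracket _ 1%N _ _ _ top_bracket_span_gen).
  by apply: ZSpanGen; exists [::].
exact: top_bracket_span_gen.
Qed.

Lemma uniq_mem_ord (s : seq 'I_m.+1) i : uniq s -> size s = m.+1 -> i \in s.
Proof.
move=> s_uniq sm; have /subset_cardP : #|s| = #|'I_m.+1|.
  by rewrite (card_uniqP s_uniq) card_ord.
by move=> /(_ (subset_predT _)) ->.
Qed.

Lemma top_bracket_full s : size s = m -> uniq (ord_max :: s) ->
  exists2 w, full m w & lie_bracket ord_max s = top_bracket w.
Proof.
move=> sm s_uniq; exists (map val s); last first.
  by rewrite /top_bracket -map_comp map_id_in // => j _ /=; rewrite inord_val.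
have smax j : j \in s -> (j < m)%N.
  move=> js; have := ltn_ord j; rewrite ltnS leq_eqVlt => /orP[/eqP jm|//].
  by move: s_uniq => /= /andP[/negP[]]; rewrite (_ : ord_max = j) //; apply: val_inj.
apply/andP; split; first apply/andP; first split.
- by rewrite map_inj_uniq; [case/andP: s_uniq | apply: val_inj].
- by apply/allP => _ /mapP[j /smax jm ->].
apply/allP => k; rewrite mem_iota /= => km.
have := @uniq_mem_ord (ord_max :: s) (inord k) s_uniq.
rewrite /= sm inE => /(_ erefl) /orP[/eqP/(congr1 val)|ks].
  by rewrite /= inordK; lia.
by apply/mapP; exists (inord k); rewrite //= inordK; lia.
Qed.

(** Monomials reduce to left-normed brackets. In weight m + 1 such a bracket vanishes if a generator
    is repeated; otherwise it contains every generator, and [bracket_top_span] brings x_m to the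
    front. *)
Lemma weight_intspan u :
  of_weight m.+1 u -> intspan (fullwords m) top_bracket u.
Proof.
have s0 := intspan0 (fullwords m) top_bracket.
have sD := @intspanD _ (fullwords m) _ top_bracket.
have sN := @intspanN _ (fullwords m) _ top_bracket.
have topP v : top_bracket_span m.+1 v -> intspan (fullwords m) top_bracket v.
  elim=> [_ [s [[sm] ->]]||v' w' _ hv _ hw|v' _ hv] //; [|exact: sD|exact: sN].
  have [s_uniq|/lie_bracket_repeated -> //] := boolP (uniq (ord_max :: s)).
  have [w fw ->] := top_bracket_full sm s_uniq.
  by apply: intspan_gen; rewrite ?fullwords_uniq ?mem_fullwords.
elim=> [v /monomial_bracket_span|//|v w _ hv _ hw|v _ hv]; [|exact: sD|exact: sN].
elim=> [_ [i [s [[sm] ->]]]||v' w' _ hv _ hw|v' _ hv] //; [|exact: sD|exact: sN].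
have [s_uniq|/lie_bracket_repeated -> //] := boolP (uniq (i :: s)).
apply: topP; have := @bracket_top_span i s; rewrite sm; apply.
by apply: uniq_mem_ord; rewrite //= sm.
Qed.

Lemma lie_bracket_monomial i s : lie_monomial (size s).+1 (lie_bracket i s).
Proof.
elim/last_ind: s => [|s j IHs]; first exact: LieMonomialGen.
rewrite size_rcons lie_bracket_rcons -[(size s).+2]addn1; apply: LieMonomialBr => //.
exact: LieMonomialGen.
Qed.

Lemma top_bracket_weight w : full m w -> of_weight m.+1 (top_bracket w).
Proof.
move=> fw; apply: WeightMonomial.
by have := lie_bracket_monomial ord_max (map inord w); rewrite size_map (full_size fw).
Qed.

End LieAction.

(** * The isomorphism *)

Section Isomorphism.
Variable m : nat.
Notation K := (cohen simplicial_circle).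

Lemma intcomb_weight a :
  weight_nb (intcomb (fullwords m) (@top_bracket m) a).
Proof.
apply/asboolP; apply: intcomb_ind => [|u v|u|w].
- exact: Weight0.
- exact: WeightD.
- exact: WeightN.
- by rewrite mem_fullwords; apply: top_bracket_weight.
Qed.

(** Copies coordinates from the commutators to the brackets of the same full words. *)
Definition sphere_lie (x : sphere K m.+1) : Lie m.+1 :=
  LieElement (intcomb_weight (fun w => top_coef (m := m) w (sphere_val x))).

Lemma sphere_lieM x y : sphere_lie (x * y)%g = sphere_lie x + sphere_lie y.
Proof.
apply: val_inj; rewrite /= -intcombD; apply: eq_bigr => w _.
by rewrite -top_coefM //; apply: sphere_top.
Qed.

Lemma sphere_expand (x : sphere K m.+1) :
  sphere_val x = intcomb (fullwords m) (top_gen m)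
    (fun w => top_coef (m := m) w (sphere_val x)).
Proof.
rewrite -(top_expand_full (h := Top (asboolT (sphere_top x)))) // => i _.
exact: (sphere_spherical x).
Qed.

Lemma sphere_lie_inj : injective sphere_lie.
Proof.
move=> x y xy; apply: val_inj; rewrite /= sphere_expand [RHS]sphere_expand.
congr top_val; apply: eq_big_seq => w; rewrite mem_fullwords => fw; congr (_ *~ _).
have /(congr1 (fun u : Lie m.+1 => lie_coef w u)) := xy.
by rewrite /= !lie_coef_intcomb.
Qed.

Lemma sphere_lie_surj l : exists x, sphere_lie x = l.
Proof.
case: l => u uw; have /asboolP/weight_intspan[a ua] := uw.
pose h : top m := intcomb (fullwords m) (top_gen m) a.
have hs : sphericalb (top_val h).
  by apply/asboolP => i; apply: face_intcomb_full.
exists (Sphere hs); apply: val_inj; rewrite /= ua; apply: eq_big_seq => w fw.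
congr (_ *~ _); apply: (dual_intcomb (fullwords_uniq m) _ (top_coefD w) fw) => v _.
by apply: top_coef_lcomm; move: fw; rewrite mem_fullwords => /full_good.
Qed.

End Isomorphism.

Theorem theorem6p7 (n : nat) (hn : (1 <= n)%N) :
  exists f : homotopy_group (cohen simplicial_circle) n -> Lie n,
    bijective f /\ forall x y, f (x * y)%g = f x + f y.
Proof.
case: n hn => // m _.
pose f (u : homotopy_group (cohen simplicial_circle) m.+1) := sphere_lie (repr u).
(* Homotopic spheres are equal, so the choice of representative does not matter. *)
have fE x : f (gclass _ x) = sphere_lie x.
  congr sphere_lie; apply: homotopic_eq.
  exact: (repr_gclass (homotopy_congr (cohen simplicial_circle) m.+1)).
exists f; split; last first.
  move=> u v; have [x ->] := gclassP u; have [y ->] := gclassP v.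
  by rewrite -gclassM !fE sphere_lieM.
have f_inj : injective f.
  move=> u v; have [x ->] := gclassP u; have [y ->] := gclassP v.
  by rewrite !fE => /sphere_lie_inj ->.
have f_surj l : exists u, f u = l.
  by have [x <-] := sphere_lie_surj l; exists (gclass _ x); apply: fE.
have [g gK] := choice f_surj; exists g => //.
by move=> u; apply: f_inj; apply: gK.
Qed.
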